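(* Assume that $d(n)=K$ for all $n$, where $K\geq 1$ is a fixed integer. Then, under $H_0:\mathcal{L}_Y=\mathcal{L}_V$, the statistic $T_n(S_n)$ converges in distribution, as $n\to\infty$, to a $\chi^2$ random variable with $1$ degree of freedom.
   Context: Model. $X=Y+Z$ and $U=V+W$ are real random variables, where $Y$ and $Z$ are independent, $V$ and $W$ are independent, and $Z$ and $W$ are independent; $Y$ and $V$ may be dependent, so $X$ and $U$ may be paired. All moments of these variables exist and characterize the associated distributions. The moments $z_i=\mathbb{E}(Z^i)$ and $w_i=\mathbb{E}(W^i)$ are known for all $i$. One observes i.i.d. pairs $(X_1,U_1),\dots,(X_n,U_n)$ distributed as $(X,U)$. $\mathcal{L}_Y$ and $\mathcal{L}_V$ denote the distributions of $Y$ and $V$. The null hypothesis is $H_0:\mathcal{L}_Y=\mathcal{L}_V$. Polynomials. $P_i$ and $Q_i$ are the polynomials of degree $i$ obtained by inverting $\mathbb{E}(X^i)=\sum_{j=0}^i\binom{i}{j}\mathbb{E}(Y^j)z_{i-j}$ and $\mathbb{E}(U^i)=\sum_{j=0}^i\binom{i}{j}\mathbb{E}(V^j)w_{i-j}$, so that $\mathbb{E}(Y^i)=\mathbb{E}(P_i(X))$ and $\mathbb{E}(V^i)=\mathbb{E}(Q_i(U))$. Explicitly, $P_0=Q_0=1$ and, for $i\ge 1$, $P_i(x)=x^i-\sum_{j=0}^{i-1}\binom{i}{j}z_{i-j}P_j(x)$ and $Q_i(x)=x^i-\sum_{j=0}^{i-1}\binom{i}{j}w_{i-j}Q_j(x)$.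 Test statistic. For $k\ge 1$ let $\mathbf{V}_s(k)=(P_i(X_s)-Q_i(U_s))_{1\le i\le k}\in\mathbb{R}^k$ (column vector), $J_n(k)=\frac{1}{\sqrt n}\sum_{s=1}^n \mathbf{V}_s(k)$, $\widehat\Sigma_n(k)=\frac1n\sum_{s=1}^n \mathbf{V}_s(k)\mathbf{V}_s(k)'$ (where $'$ denotes transposition), and $T_n(k)=J_n(k)'\,\widehat\Sigma_n(k)^{-1}J_n(k)$. It is assumed throughout that the matrices $\widehat\Sigma_n(k)$, $1\le k\le d(n)$, are positive definite (almost surely, for $n$ large enough), so that their inverses exist. Data-driven selection. $S_n$ is the smallest element of $\operatorname{argmax}_{1\le k\le d(n)}\big(T_n(k)-k\log n\big)$, and $T_n(S_n)$ is $T_n(k)$ evaluated at $k=S_n$. *)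

(* Defs.v *)
From HB Require Import structures.
From mathcomp Require Export all_boot all_order all_algebra.
From mathcomp Require Export all_classical all_reals all_analysis measurable_realfun.

Set Implicit Arguments.
Unset Strict Implicit.
Unset Printing Implicit Defensive.

Export Order.TTheory GRing.Theory Num.Theory.
Export numFieldNormedType.Exports.

Global Open Scope classical_set_scope.
Global Open Scope ring_scope.

Section Laws.
Context {d : measure_display} {Omega : measurableType d} {R : realType}.
Variable P : probability Omega R.

Definition independent_pair {d1 d2 : measure_display}
    {T1 : measurableType d1} {T2 : measurableType d2}
    (X : Omega -> T1) (Y : Omega -> T2) : Prop :=
  forall (A : set T1) (B : set T2), measurable A -> measurable B ->
    P (X @^-1` A `&` Y @^-1` B) = (P (X @^-1` A) * P (Y @^-1` B))%E.

Definition mutually_independent {d1 : measure_display} {T1 : measurableType d1}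
    (X : nat -> Omega -> T1) : Prop :=
  forall (I : seq nat) (A : nat -> set T1),
    uniq I -> (forall i, measurable (A i)) ->
    P (\bigcap_(i in [set` I]) (X i @^-1` A i)) =
    (\prod_(i <- I) P (X i @^-1` A i))%E.

Definition same_law {d1 : measure_display} {T1 : measurableType d1}
    (X Y : Omega -> T1) : Prop :=
  forall A : set T1, measurable A -> P (X @^-1` A) = P (Y @^-1` A).

Definition has_all_moments (X : Omega -> R) : Prop :=
  forall i : nat, P.-integrable setT (fun w => (X w ^+ i)%:E).

(* The value is meaningful under has_all_moments (fine sends infinities to 0). *)
Definition moment (X : Omega -> R) (i : nat) : R :=
  fine 'E_P[fun w => X w ^+ i].

Definition moment_determinate (X : Omega -> R) : Prop :=
  forall mu : probability (measurableTypeR R) R,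
    (forall i : nat, mu.-integrable setT (fun x : R => (x ^+ i)%:E) /\
       (\int[mu]_x (x ^+ i)%:E = (moment X i)%:E)%E) ->
    forall A : set R, measurable A -> mu A = P (X @^-1` A).

(* Measurability of the T n is part of the notion: they are random variables. *)
Definition cvg_in_distribution (T : nat -> Omega -> R)
    (mu : probability (measurableTypeR R) R) : Prop :=
  (forall n, measurable_fun setT (T n)) /\
  (forall x : R, {for x, continuous (fun y : R => mu `]-oo, y]%classic)} ->
     P [set w | T n w <= x] @[n --> \oo] --> mu `]-oo, x]%classic).

End Laws.

Section ChiSquare.
Context {R : realType}.

Definition sqr_fun (x : measurableTypeR R) : measurableTypeR R := (x : R) ^+ 2.

Lemma measurable_sqr_fun : measurable_fun setT sqr_fun.
Proof. by exact: exprn_measurable. Qed.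

HB.instance Definition _ :=
  isMeasurableFun.Build _ _ _ _ sqr_fun measurable_sqr_fun.

(* Chi-square law with one degree of freedom: law of the square of N(0, 1). *)
Definition chi_square1 : probability (measurableTypeR R) R :=
  distribution (@normal_prob R 0 1) sqr_fun.

End ChiSquare.

Section Statistic.
Context {R : realType}.

Fixpoint deconv_polys (m : nat -> R) (n : nat) : seq {poly R} :=
  if n is i.+1 then
    let s := deconv_polys m i in
    rcons s ('X^i - \sum_(j < i) ('C(i, j)%:R * m (i - j)%N) *: s`_j)
  else [::].

(* For m the moments of Z, this is P_i; its recurrence is deconv_polyE. *)
Definition deconv_poly (m : nat -> R) (i : nat) : {poly R} :=
  (deconv_polys m i.+1)`_i.

Lemma size_deconv_polys m n : size (deconv_polys m n) = n.
Proof. by elim: n => //= n IH; rewrite size_rcons IH. Qed.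

Lemma nth_deconv_polys m n i : (i < n)%N ->
  (deconv_polys m n)`_i = deconv_poly m i.
Proof.
elim: n => // n IH; rewrite ltnS leq_eqVlt => /orP[/eqP -> //|lt_in].
by rewrite /= nth_rcons size_deconv_polys lt_in IH.
Qed.

Lemma deconv_polyE m i :
  deconv_poly m i =
  'X^i - \sum_(j < i) ('C(i, j)%:R * m (i - j)%N) *: deconv_poly m j.
Proof.
rewrite {1}/deconv_poly /= nth_rcons size_deconv_polys ltnn eqxx.
by congr (_ - _); apply: eq_bigr => j _; rewrite nth_deconv_polys.
Qed.

Lemma deconv_poly0 m : deconv_poly m 0 = 1.
Proof. by rewrite deconv_polyE big_ord0 subr0 expr0. Qed.

(* z and w are the moment sequences of Z and W; x and u are the observed
   samples, the s-th observation (s >= 1) being stored at index s - 1. *)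
Variables (z w x u : nat -> R).

Definition score (k s : nat) : 'cV[R]_k :=
  \col_(i < k) ((deconv_poly z i.+1).[x s] - (deconv_poly w i.+1).[u s]).

Definition Jstat (n k : nat) : 'cV[R]_k :=
  (Num.sqrt n%:R)^-1 *: \sum_(s < n) score k s.

Definition Sigma_hat (n k : nat) : 'M[R]_k :=
  n%:R^-1 *: \sum_(s < n) (score k s *m (score k s)^T).

Definition Tstat (n k : nat) : R :=
  ((Jstat n k)^T *m invmx (Sigma_hat n k) *m Jstat n k) 0 0.

Definition least_argmax (L : nat -> R) (d : nat) : nat :=
  head 0%N [seq k <- iota 1 d | all (fun j => L j <= L k) (iota 1 d)].

Definition Sstat (d n : nat) : nat :=
  least_argmax (fun k => Tstat n k - k%:R * ln n%:R) d.

End Statistic.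

Lemma least_argmaxP (R : realType) (L : nat -> R) (d : nat) : (0 < d)%N ->
  let S := least_argmax L d in
  [/\ (1 <= S <= d)%N,
      forall j, (1 <= j <= d)%N -> L j <= L S &
      forall k, (1 <= k <= d)%N ->
        (forall j, (1 <= j <= d)%N -> L j <= L k) -> (S <= k)%N].
Proof.
move=> d0 S; set M := fun k => all (fun j => L j <= L k) (iota 1 d).
have inI j : (j \in iota 1 d) = (1 <= j <= d)%N by rewrite mem_iota add1n ltnS.
have MP k : reflect (forall j, (1 <= j <= d)%N -> L j <= L k) (M k).
  apply: (iffP allP) => h j; first by rewrite -inI; exact: h.
  by rewrite inI; exact: h.
have [k0 k0d Mk0] : exists2 k, k \in iota 1 d & M k.
  case: (@arg_maxP _ _ _ (Ordinal d0) xpredT (fun i : 'I_d => L i.+1)) => //.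
  move=> i _ imax; exists i.+1; first by rewrite inI /= ltn_ord.
  apply/MP => -[//|j] /andP[_ jd]; exact: (imax (Ordinal jd)).
have SE : S = head 0%N [seq k <- iota 1 d | M k] by [].
have srt : sorted ltn [seq k <- iota 1 d | M k].
  by apply: sorted_filter; [exact: ltn_trans|exact: iota_ltn_sorted].
have : k0 \in [seq k <- iota 1 d | M k] by rewrite mem_filter Mk0.
case E : [seq k <- iota 1 d | M k] SE srt => [//|a l] /= SE srt _.
have : a \in [seq k <- iota 1 d | M k] by rewrite E mem_head.
rewrite mem_filter inI SE => /andP[/MP aM ad]; split => // k kd /MP kM.
have : k \in [seq k <- iota 1 d | M k] by rewrite mem_filter kM inI.
rewrite E inE => /orP[/eqP -> //|kl].
have /allP := order_path_min ltn_trans srt.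
by move=> /(_ k kl) /ltnW.
Qed.

Definition posdefmx (R : realType) (n : nat) (A : 'M[R]_n) : Prop :=
  A^T = A /\ forall v : 'cV[R]_n, v != 0 -> 0 < (v^T *m A *m v) 0 0.

(* Main.v *)
(* Under the null hypothesis the vectors V_s(k) are i.i.d., centred and have all
   moments. Their covariance matrix is positive definite: otherwise a fixed
   linear combination of the coordinates vanishes almost surely and every
   empirical matrix is singular. By the weak law of large numbers the empirical
   matrices are therefore uniformly coercive with probability tending to 1, so
   T_n(k) <= C |J_n(k)|^2, and since E |J_n(k)|^2 is bounded,
   P(T_n(k) >= ln n) -> 0 for every k. As T_n(1) >= 0, S_n >= 2 would force
   T_n(S_n) >= ln n; hence S_n = 1 with probability tending to 1. Finally
   T_n(1) is the square of a normalised sum divided by a consistent estimator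
   of its variance. The central limit theorem for this sum is obtained by
   Lindeberg's replacement argument, in Trotter's operator form: summands are
   replaced by Gaussian convolution operators, so that Omega need not carry any
   Gaussian variable. *)
Require Import Defs.
From mathcomp Require Import ring lra.

Set Implicit Arguments.
Unset Strict Implicit.
Unset Printing Implicit Defensive.

(** The limit is that of a ratio [Wn ^+ 2 / Rn], yet it is reached without Slutsky's theorem or
    continuous mapping: the distribution function of the statistic is squeezed between expectations
    of smooth plateau functions of the normalised sum, equal to 1 on a symmetric interval and to 0
    off a slightly larger one. The gap between the two intervals absorbs the error of the variance
    estimator, so the central limit theorem is needed for such test functions only. The replacement
    argument applies Gaussian convolution n times, which calls for a class of test functions on
    which it acts without enlarging the constants. Rather than differentiate under the integral
    sign, the class is defined by a second-order Taylor inequality with cubic remainder, which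
    passes through an integral by linearity. Each replacement costs a multiple of [n^(-3/2)], n of
    them a multiple of [n^(-1/2)], and the Gaussian side is exact for every n. Events of small
    probability are collected in explicit exceptional sets; off them every estimate is a
    deterministic inequality at one sample point. *)

Section IntegrableEFin.
Context {d} {T : measurableType d} {R : realType}.
Implicit Types (mu : {measure set T -> \bar R}) (f g : T -> R).

Lemma integrable_EFin_measurable mu f :
  mu.-integrable setT (EFin \o f) -> measurable_fun setT f.
Proof. by move=> /measurable_int/measurable_EFinP. Qed.

Lemma integrable_EFinD mu f g : mu.-integrable setT (EFin \o f) ->
  mu.-integrable setT (EFin \o g) ->
  mu.-integrable setT (EFin \o (fun x => f x + g x)).
Proof. by move=> fi gi; exact: (integrableD measurableT fi gi). Qed.

Lemma integrable_EFinZ mu (c : R) f : mu.-integrable setT (EFin \o f) ->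
  mu.-integrable setT (EFin \o (fun x => c * f x)).
Proof. by move=> fi; exact: (integrableZl measurableT c fi). Qed.

Lemma integrable_EFinB mu f g : mu.-integrable setT (EFin \o f) ->
  mu.-integrable setT (EFin \o g) ->
  mu.-integrable setT (EFin \o (fun x => f x - g x)).
Proof. by move=> fi gi; exact: (integrableB measurableT fi gi). Qed.

Lemma integrable_EFin_sum mu (I : Type) (s : seq I) (F : I -> T -> R) :
  (forall i, mu.-integrable setT (EFin \o F i)) ->
  mu.-integrable setT (EFin \o (fun x => \sum_(i <- s) F i x)).
Proof.
move=> Fi; have := @integrable_sum _ _ _ mu _ measurableT _ s xpredT
  (fun i x => (F i x)%:E) (fun i _ => Fi i).
by apply: eq_integrable => // x _; rewrite /= sumEFin.
Qed.

Lemma integrable_EFin_le mu f g : measurable_fun setT f ->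
  (forall x, `|f x| <= g x) -> mu.-integrable setT (EFin \o g) ->
  mu.-integrable setT (EFin \o f).
Proof.
move=> mf fg; apply: le_integrable => //; first exact/measurable_EFinP.
by move=> x _; rewrite /= lee_fin (le_trans (fg x))// ler_norm.
Qed.

Lemma integrable_EFin_norm mu f : mu.-integrable setT (EFin \o f) ->
  mu.-integrable setT (EFin \o (fun x => `|f x|)).
Proof. by move=> /integrable_abse. Qed.

End IntegrableEFin.

Section IntegrableProba.
Context {d} {T : measurableType d} {R : realType}.
Variable P : probability T R.
Implicit Types f g : T -> R.

Lemma integrable_EFin_cst (c : R) : P.-integrable setT (EFin \o (fun=> c)).
Proof. exact: finite_measure_integrable_cst. Qed.

Lemma integrable_EFin_bounded (M : R) f : measurable_fun setT f ->
  (forall x, `|f x| <= M) -> P.-integrable setT (EFin \o f).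
Proof. by move=> mf fM; apply: integrable_EFin_le mf fM _; exact: integrable_EFin_cst. Qed.

Lemma Rintegral_prob_cst (c : R) : \int[P]_x c = c.
Proof. by rewrite /Rintegral integral_cst//= probability_setT mule1. Qed.

Lemma Rintegral_sum (I : Type) (s : seq I) (F : I -> T -> R) :
  (forall i, P.-integrable setT (EFin \o F i)) ->
  \int[P]_x (\sum_(i <- s) F i x) = \sum_(i <- s) \int[P]_x F i x.
Proof.
move=> Fi; elim: s => [|i s IH].
  by under eq_Rintegral do rewrite big_nil; rewrite Rintegral_prob_cst big_nil.
under eq_Rintegral do rewrite big_cons.
by rewrite RintegralD// ?IH ?big_cons//; exact: integrable_EFin_sum.
Qed.

Lemma Rintegral_close f g (M : R) : P.-integrable setT (EFin \o f) ->
  P.-integrable setT (EFin \o g) -> (forall x, `|f x - g x| <= M) ->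
  `|\int[P]_x f x - \int[P]_x g x| <= M.
Proof.
move=> fi gi fg; rewrite -RintegralB//; have fgi := integrable_EFinB fi gi.
rewrite (le_trans (le_normr_Rintegral measurableT fgi))//.
rewrite -[leRHS](Rintegral_prob_cst M) le_Rintegral//.
- exact: integrable_EFin_norm.
- exact: integrable_EFin_cst.
Qed.

End IntegrableProba.

(** * Smooth plateau functions *)

Section SmoothStep.
Context {R : realType}.
Implicit Types x y h : R.

Definition clamp x : R := Num.min (Num.max x 0) 1.

Lemma clampP x : [\/ x <= 0 /\ clamp x = 0, 0 <= x <= 1 /\ clamp x = x |
  1 <= x /\ clamp x = 1].
Proof.
have [x0|x0] := leP x 0; first by constructor 1; rewrite /clamp max_r// min_l.
have [x1|x1] := leP x 1.
  by constructor 2; rewrite /clamp max_l ?min_l ?(ltW x0).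
by constructor 3; rewrite /clamp max_l ?min_r ?(ltW x1) ?(ltW x0).
Qed.

Lemma clamp_itv x : 0 <= clamp x <= 1.
Proof. by have [[_ ->]|[? ->]|[_ ->]] := clampP x; rewrite ?lexx ?ler01. Qed.

Lemma clamp_lip x y : `|clamp x - clamp y| <= `|x - y|.
Proof.
have [[? ->]|[/andP[? ?] ->]|[? ->]] := clampP x;
have [[? ->]|[/andP[? ?] ->]|[? ->]] := clampP y;
  rewrite ler_norml; case: (ler0P (x - y)) => ?; apply/andP; split; lra.
Qed.

(* The quintic [10 c^3 - 15 c^4 + 6 c^5], its derivative and its second
   derivative; both derivatives vanish at 0 and at 1. *)
Definition smoothstep x : R :=
  let c := clamp x in c ^+ 3 * (10 - 15 * c + 6 * c ^+ 2).
Definition smoothstep1 x : R :=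
  let c := clamp x in 30 * (c * (1 - c)) ^+ 2.
Definition smoothstep2 x : R :=
  let c := clamp x in 60 * c * (1 - c) * (1 - 2 * c).

(* The clamping error [d - h] is nonzero only if [clamp x] lies within [`|h|] of
   0 or 1, where the two derivatives are small. *)
Lemma smoothstep_taylor x h :
  `|smoothstep (x + h) - smoothstep x - smoothstep1 x * h
    - smoothstep2 x * h ^+ 2 / 2| <= 1000 * `|h| ^+ 3.
Proof.
set c := clamp x; set d := clamp (x + h) - c.
have dh : `|d| <= `|h| by rewrite (le_trans (clamp_lip _ _))// addrAC subrr add0r.
have /andP[c0 c1] : 0 <= c <= 1 := clamp_itv x.
have d1 : `|d| <= 1.
  have /andP[? ?] := clamp_itv (x + h).
  by rewrite ler_norml /d; apply/andP; split; lra.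
(* Exact expansion of the quintic in the clamped increment [d]: a multiple of [d ^+ 3], plus the
   cost of replacing [d] by [h] in the first and second order terms. *)
have -> : smoothstep (x + h) - smoothstep x - smoothstep1 x * h
    - smoothstep2 x * h ^+ 2 / 2 =
  d ^+ 3 * (10 - 60 * c + 60 * c ^+ 2 + (30 * c - 15) * d + 6 * d ^+ 2)
  + 30 * (c * (1 - c)) ^+ 2 * (d - h)
  + 60 * c * (1 - c) * (1 - 2 * c) * (d ^+ 2 - h ^+ 2) / 2.
  rewrite /smoothstep /smoothstep1 /smoothstep2 -/c.
  have -> : clamp (x + h) = c + d by rewrite /d addrCA subrr addr0.
  by field.
have edge : d = h \/ c * (1 - c) <= `|h|.
  rewrite /d /c; have [[? ->]|[/andP[? ?] ->]|[? ->]] := clampP x.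
  - by right; rewrite mul0r.
  - have [[? ->]|[/andP[? ?] ->]|[? ->]] := clampP (x + h).
    + right; apply: (@le_trans _ _ x); first by nra.
      by rewrite ler0_norm; lra.
    + by left; lra.
    + right; apply: (@le_trans _ _ (1 - x)); first by nra.
      by rewrite ger0_norm; lra.
  - by right; rewrite subrr mulr0.
have cc0 : 0 <= c * (1 - c) by rewrite mulr_ge0 ?subr_ge0.
have cc1 : c * (1 - c) <= 1 by rewrite mulr_ile1 ?subr_ge0// lerBlDr lerDl.
(* The constants are generous: for [0 <= c <= 1] and [|d| <= 1] the bracket is at most 10 + 15 + 6
   in absolute value, and 500 + 60 + 60 stays below 1000. *)
have A1 : `|d ^+ 3 * (10 - 60 * c + 60 * c ^+ 2 + (30 * c - 15) * d + 6 * d ^+ 2)|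
    <= 500 * `|h| ^+ 3.
  rewrite normrM mulrC normrX ler_pM ?exprn_ge0 ?lerXn2r ?nnegrE//.
  have [d2 d3] : -1 <= d /\ d <= 1 by move: d1; rewrite ler_norml => /andP[].
  by rewrite ler_norml; apply/andP; split; nra.
have A2 : `|30 * (c * (1 - c)) ^+ 2 * (d - h)| <= 60 * `|h| ^+ 3.
  case: edge => [->|cch]; first by rewrite subrr mulr0 normr0 mulr_ge0 ?exprn_ge0.
  rewrite (_ : 60 * `|h| ^+ 3 = 30 * `|h| ^+ 2 * (`|h| + `|h|)); last by ring.
  rewrite normrM ler_pM//.
    rewrite normrM (ger0_norm (_ : 0 <= 30))// ler_wpM2l//.
    by rewrite normrX (ger0_norm cc0) lerXn2r ?nnegrE.
  by rewrite (le_trans (ler_normB _ _))// lerD2r.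
have A3 : `|60 * c * (1 - c) * (1 - 2 * c) * (d ^+ 2 - h ^+ 2) / 2|
    <= 60 * `|h| ^+ 3.
  case: edge => [->|cch].
    by rewrite subrr mulr0 mul0r normr0 mulr_ge0 ?exprn_ge0.
  rewrite (_ : 60 * c * _ * _ * _ / 2 =
    30 * (c * (1 - c)) * ((1 - 2 * c) * (d ^+ 2 - h ^+ 2))); last by field.
  rewrite (_ : 60 * `|h| ^+ 3 = 30 * `|h| * (2 * `|h| ^+ 2)); last by ring.
  rewrite normrM ler_pM//.
    by rewrite normrM (ger0_norm (_ : 0 <= 30))// (ger0_norm cc0) ler_wpM2l.
  rewrite normrM (_ : 2 * `|h| ^+ 2 = 1 * (`|h| ^+ 2 + `|h| ^+ 2)); last by ring.
  rewrite ler_pM//; first by rewrite ler_norml; apply/andP; split; lra.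
  rewrite (le_trans (ler_normB _ _))// !normrX lerD2r.
  by rewrite lerXn2r ?nnegrE.
rewrite (le_trans (ler_normD _ _))//.
have := ler_normD (d ^+ 3 * (10 - 60 * c + 60 * c ^+ 2 + (30 * c - 15) * d
  + 6 * d ^+ 2)) (30 * (c * (1 - c)) ^+ 2 * (d - h)).
have : 0 <= `|h| ^+ 3 by rewrite exprn_ge0.
move: A1 A2 A3; lra.
Qed.

Lemma smoothstep_itv x : 0 <= smoothstep x <= 1.
Proof.
rewrite /smoothstep; have /andP[] := clamp_itv x; move: (clamp x) => c c0 c1.
have e : 10 - 15 * c + 6 * c ^+ 2 = 1 + 3 * (1 - c) + 6 * (1 - c) ^+ 2 :> R by ring.
apply/andP; split.
  rewrite mulr_ge0 ?exprn_ge0//; rewrite e.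
  have : 0 <= (1 - c) ^+ 2 by exact: sqr_ge0. lra.
(* The reflection [c -> 1 - c] exchanges the quintic with its complement to 1, so the upper bound is
   the lower bound reflected. *)
rewrite -subr_ge0.
rewrite (_ : _ - _ = (1 - c) ^+ 3 * (1 + 3 * c + 6 * c ^+ 2)); last by ring.
rewrite mulr_ge0 ?exprn_ge0 ?subr_ge0//.
have : 0 <= c ^+ 2 by exact: sqr_ge0. lra.
Qed.

Lemma smoothstep_le0 x : x <= 0 -> smoothstep x = 0.
Proof.
rewrite /smoothstep; have [[? ->]|[/andP[? ?] ->]|[? ->]] := clampP x => x0.
- by rewrite expr0n mul0r.
- by rewrite (_ : x = 0) ?expr0n ?mul0r//; lra.
- lra.
Qed.

Lemma smoothstep_ge1 x : 1 <= x -> smoothstep x = 1.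
Proof.
rewrite /smoothstep; have [[? ->]|[/andP[? ?] ->]|[? ->]] := clampP x => x1.
- lra.
- by rewrite (_ : x = 1); [ring|lra].
- by ring.
Qed.

(** One constant serves as supremum bound and as Lipschitz constant. The Lipschitz half gives
    measurability, the bound gives integrability against any probability, so that compositions with
    random variables need no further side condition. *)
Definition bounded_lip (M : R) (f : R -> R) :=
  (forall x, `|f x| <= M) /\ (forall x y, `|f x - f y| <= M * `|x - y|).

Lemma bounded_lipW M N f : M <= N -> bounded_lip M f -> bounded_lip N f.
Proof.
move=> MN [fM fL]; split => [x|x y]; first exact: le_trans MN.
by rewrite (le_trans (fL _ _))// ler_wpM2r.
Qed.

Lemma bounded_lip_ge0 M f : bounded_lip M f -> 0 <= M.
Proof. by move=> [fM _]; exact: le_trans (fM 0). Qed.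

Lemma bounded_lip_cst c : bounded_lip `|c| (fun=> c).
Proof. by split => // x y; rewrite subrr normr0 mulr_ge0. Qed.

Lemma bounded_lipD M N f g : bounded_lip M f -> bounded_lip N g ->
  bounded_lip (M + N) (fun x => f x + g x).
Proof.
move=> [fM fL] [gM gL]; split => [x|x y].
  by rewrite (le_trans (ler_normD _ _))// lerD.
rewrite opprD addrACA (le_trans (ler_normD _ _))// mulrDl lerD//.
Qed.

Lemma bounded_lipM M N f g : bounded_lip M f -> bounded_lip N g ->
  bounded_lip (M * N *+ 2) (fun x => f x * g x).
Proof.
move=> bf bg; have M0 := bounded_lip_ge0 bf; have N0 := bounded_lip_ge0 bg.
move: bf bg => [fM fL] [gM gL]; split => [x|x y].
  rewrite normrM (@le_trans _ _ (M * N))// ?ler_pM//.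
  by rewrite mulr2n lerDl mulr_ge0.
have -> : f x * g x - f y * g y = (f x - f y) * g x + f y * (g x - g y) by ring.
rewrite (le_trans (ler_normD _ _))// mulr2n [leRHS]mulrDl lerD// normrM.
- by rewrite mulrAC ler_pM.
- by rewrite -mulrA ler_pM.
Qed.

Lemma bounded_lip_affine M f a b : bounded_lip M f ->
  bounded_lip (M * (1 + `|b|)) (fun x => f (a + b * x)).
Proof.
move=> bf; have M0 := bounded_lip_ge0 bf; case: bf => [fM fL].
split => [x|x y]; first by rewrite (le_trans (fM _))// ler_peMr// lerDl.
rewrite (le_trans (fL _ _))// -mulrA ler_wpM2l// opprD addrACA subrr add0r.
by rewrite -mulrBr normrM ler_wpM2r// lerDr.
Qed.

(* [f1] and [f2] play the role of the first two derivatives of [f]; only this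
   Taylor bound is ever used, so no differentiability is required. *)
Definition smooth3 (M : R) (f f1 f2 : R -> R) :=
  [/\ bounded_lip M f, bounded_lip M f1, bounded_lip M f2 &
    forall x h, `|f (x + h) - f x - f1 x * h - f2 x * h ^+ 2 / 2| <=
      M * `|h| ^+ 3].

(** The three functions are polynomials in [clamp], and bounded Lipschitz functions are closed under
    sums and products; their bounds follow by induction on the polynomial, and [smoothstep_taylor]
    supplies the rest. *)
Lemma smooth3_smoothstep :
  exists M, smooth3 M smoothstep smoothstep1 smoothstep2.
Proof.
have bc : bounded_lip 1 clamp.
  split => [x|x y]; last by rewrite mul1r clamp_lip.
  by have /andP[? ?] := clamp_itv x; rewrite ger0_norm.
have cst := bounded_lip_cst.
have poly (p : {poly R}) : exists M, bounded_lip M (fun x => p.[clamp x]).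
  elim/poly_ind: p => [|p c [M bM]].
    exists `|0 : R|; under eq_fun do rewrite horner0; exact: cst.
  exists (M * 1 *+ 2 + `|c|); under eq_fun do rewrite hornerMXaddC.
  exact: bounded_lipD (bounded_lipM bM bc) (cst _).
have [M0 b0] := poly ('X^3 * (10%:P - 15 *: 'X + 6 *: 'X^2)).
have [M1 b1] := poly (30 *: ('X * (1 - 'X)) ^+ 2).
have [M2 b2] := poly ((60 *: 'X) * (1 - 'X) * (1 - 2 *: 'X)).
have e0 := bounded_lip_ge0 b0; have e1 := bounded_lip_ge0 b1.
have e2 := bounded_lip_ge0 b2.
exists (1000 + M0 + M1 + M2); split.
- suff -> : smoothstep = fun x => ('X^3 * (10%:P - 15 *: 'X + 6 *: 'X^2)).[clamp x].
    by apply: bounded_lipW b0; lra.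
  by apply/funext => x; rewrite /smoothstep /smoothstep1 /smoothstep2 !hornerE/=; ring.
- suff -> : smoothstep1 = fun x => (30 *: ('X * (1 - 'X)) ^+ 2).[clamp x].
    by apply: bounded_lipW b1; lra.
  by apply/funext => x; rewrite /smoothstep /smoothstep1 /smoothstep2 !hornerE/=; ring.
- suff -> : smoothstep2 =
      fun x => ((60 *: 'X) * (1 - 'X) * (1 - 2 *: 'X)).[clamp x].
    by apply: bounded_lipW b2; lra.
  by apply/funext => x; rewrite /smoothstep /smoothstep1 /smoothstep2 !hornerE/=; ring.
- move=> x h; rewrite (le_trans (smoothstep_taylor _ _))//.
  by rewrite ler_wpM2r ?exprn_ge0//; lra.
Qed.

Lemma smooth3_affine M f f1 f2 a b : smooth3 M f f1 f2 ->
  exists N, smooth3 N (fun x => f (a + b * x)) (fun x => b * f1 (a + b * x))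
    (fun x => b ^+ 2 * f2 (a + b * x)).
Proof.
move=> [bf bf1 bf2 tf]; have M0 := bounded_lip_ge0 bf.
have c0 := bounded_lip_affine a b bf.
have c1 := bounded_lipM (bounded_lip_cst b) (bounded_lip_affine a b bf1).
have c2 := bounded_lipM (bounded_lip_cst (b ^+ 2)) (bounded_lip_affine a b bf2).
set K0 := (X in bounded_lip X _) in c0.
set K1 := (X in bounded_lip X _) in c1.
set K2 := (X in bounded_lip X _) in c2.
have e0 := bounded_lip_ge0 c0; have e1 := bounded_lip_ge0 c1.
have e2 := bounded_lip_ge0 c2; have e3 : 0 <= M * `|b| ^+ 3.
  by rewrite mulr_ge0 ?exprn_ge0.
exists (K0 + K1 + K2 + M * `|b| ^+ 3); split.
- by apply: bounded_lipW c0; lra.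
- by apply: bounded_lipW c1; lra.
- by apply: bounded_lipW c2; lra.
move=> x h; apply: (@le_trans _ _ (M * `|b| ^+ 3 * `|h| ^+ 3)); last first.
  by rewrite ler_wpM2r ?exprn_ge0//; lra.
have := tf (a + b * x) (b * h); rewrite normrM !exprMn (mulrA M).
move=> /(le_trans _); apply.
rewrite le_eqVlt; apply/orP; left; apply/eqP; congr (`|_|); rewrite mulrDr addrA.
by move: (f _) (f _) (f1 _) (f2 _) => *; field.
Qed.

Lemma smooth3B M N f f1 f2 g g1 g2 : smooth3 M f f1 f2 -> smooth3 N g g1 g2 ->
  smooth3 (M + N) (fun x => f x - g x) (fun x => f1 x - g1 x)
    (fun x => f2 x - g2 x).
Proof.
have neg K k : bounded_lip K k -> bounded_lip K (fun x => - k x).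
  move=> [kM kL]; split => [x|x y]; first by rewrite normrN.
  by rewrite -opprD normrN.
move=> [bf bf1 bf2 tf] [bg bg1 bg2 tg]; split.
- exact: bounded_lipD bf (neg _ _ bg).
- exact: bounded_lipD bf1 (neg _ _ bg1).
- exact: bounded_lipD bf2 (neg _ _ bg2).
move=> x h; rewrite [leRHS]mulrDl.
apply: le_trans (lerD (tf x h) (tg x h)); apply: le_trans (ler_normB _ _).
rewrite le_eqVlt; apply/orP; left; apply/eqP; congr (`|_|).
by move: (f _) (f _) (f1 _) (f2 _) (g _) (g _) (g1 _) (g2 _) => *; field.
Qed.

(** Difference of two descending steps: the first falls from 1 to 0 on [[a, b]], the second on
    [[-b, -a]]. The conclusions are phrased with squares because the plateau is evaluated at a
    normalised sum whose square is the statistic up to the variance estimate. *)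
Lemma plateau a b : 0 <= a < b -> exists M f f1 f2,
  [/\ smooth3 M f f1 f2, (forall x, 0 <= f x <= 1),
      forall x, x ^+ 2 <= a ^+ 2 -> f x = 1 &
      forall x, b ^+ 2 < x ^+ 2 -> f x = 0].
Proof.
move=> /andP[a0 ab]; set d := (b - a)^-1.
have d0 : 0 < d by rewrite invr_gt0 subr_gt0.
have db : d * (b - a) = 1 by rewrite mulVf// subr_eq0 gt_eqF.
have b0 : 0 <= b by lra.
have [M sM] := smooth3_smoothstep.
have [M1 s1] := smooth3_affine (d * b) (- d) sM.
have [M2 s2] := smooth3_affine (- d * a) (- d) sM.
have := smooth3B s1 s2.
set f := (fun x => smoothstep _ - _); set f1 := (fun x => _ - _).
set f2 := (fun x => _ - _) => sf; exists (M1 + M2), f, f1, f2; split => //.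
(* At every point one of the two steps is constant: right of [- a] the second is 0, left of it the
   first is 1. *)
- move=> x; rewrite /f; have [xa|xa] := lerP (- a) x.
    by rewrite (@smoothstep_le0 (- d * a + _)) ?subr0 ?smoothstep_itv//; nra.
  rewrite (@smoothstep_ge1 (d * b + _)); last by nra.
  have /andP[? ?] := smoothstep_itv (- d * a + - d * x).
  by rewrite subr_ge0 lerBlDr lerDl; apply/andP; split.
- move=> x; rewrite -[leLHS]real_normK ?num_real// ler_sqr ?nnegrE// ler_norml.
  move=> /andP[ax xa]; rewrite /f smoothstep_ge1; last by nra.
  by rewrite smoothstep_le0 ?subr0//; nra.
- move=> x; rewrite -[ltRHS]real_normK ?num_real// ltr_sqr ?nnegrE// => bx.
  rewrite /f; have [x0|x0] := ler0P x.
    by rewrite ler0_norm// in bx; rewrite !smoothstep_ge1 ?subrr//; nra.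
  by rewrite gtr0_norm// in bx; rewrite !smoothstep_le0 ?subrr//; nra.
Qed.

End SmoothStep.

(** * Gaussian convolution *)

Section Gauss.
Context {R : realType}.
Local Notation leb := (@lebesgue_measure R).

(** The Radon-Nikodym derivative of the normal law and its explicit density have the same integral
    over every measurable set, hence agree almost everywhere. *)
Lemma ge0_integral_normal_prob (m s : R) (f : R -> \bar R) :
  (forall x, 0 <= f x)%E -> measurable_fun setT f ->
  (\int[normal_prob m s]_x f x = \int[leb]_x (f x * (normal_pdf m s x)%:E))%E.
Proof.
move=> f0 mf.
have dom := @normal_prob_dominates R m s.
rewrite -(Radon_Nikodym_SigmaFinite.change_of_variables dom)//.
have iRN := Radon_Nikodym_SigmaFinite.f_integrable dom.
apply: ae_eq_integral => //.
- apply: emeasurable_funM => //; exact: (measurable_int leb).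
- apply: emeasurable_funM => //; apply/measurable_EFinP.
  exact: measurable_normal_pdf.
- apply: ae_eqe_mul2l => /=.
  apply: integral_ae_eq => //=.
  + by apply/measurable_EFinP; exact: measurable_normal_pdf.
  + by move=> E _ mE; rewrite -Radon_Nikodym_SigmaFinite.f_integral.
Qed.

Local Notation gauss := (@normal_prob R 0 1).

Lemma normal_peakM (s : R) : 0 < s -> normal_peak s * s = normal_peak 1.
Proof.
move=> s0; rewrite /normal_peak expr1n mul1r.
rewrite -mulrnAr sqrtrM ?sqr_ge0// sqrtr_sqr gtr0_norm// invfM mulrAC.
by rewrite mulVf ?mul1r// gt_eqF.
Qed.

Lemma normal_pdf_affine (m s y : R) : 0 < s ->
  normal_pdf m s (m + s * y) * s = normal_pdf 0 1 y.
Proof.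
move=> s0; rewrite !normal_pdfE ?oner_eq0 ?gt_eqF// mulrAC normal_peakM//.
congr (_ * _); rewrite /normal_fun; congr expR; field.
by rewrite gt_eqF.
Qed.

Lemma integral_normal_prob_affine (m s : R) (f : R -> R) : 0 < s ->
  continuous f -> (forall x, 0 <= f x) ->
  (\int[normal_prob m s]_x (f x)%:E = \int[gauss]_y (f (m + s * y)%R)%:E)%E.
Proof.
move=> s0 cf f0; pose F y := m + s * y.
have dF (x : R) : is_derive x 1 F s.
  by apply: is_derive_eq; rewrite /GRing.scale/=; ring.
have F'E : F^`()%classic = cst s.
  by apply/funext => x; rewrite derive1E; apply: derive_val.
have cF : continuous F.
  by move=> x; apply: differentiable_continuous; apply/derivable1_diffP.
have mf : measurable_fun setT (fun x => (f x)%:E).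
  by apply/measurable_EFinP; exact: continuous_measurable_fun.
have mfF : measurable_fun setT (fun y => (f (m + s * y))%:E).
  apply/measurable_EFinP; apply: continuous_measurable_fun => x.
  by apply: continuous_comp; [exact: cF|exact: cf].
rewrite (ge0_integral_normal_prob m s)// ?(ge0_integral_normal_prob 0 1)//;
  do ?[by move=> x; rewrite lee_fin].
have := @increasing_ge0_integration_by_substitutionT R F
  (fun x => f x * normal_pdf m s x).
under eq_integral do rewrite EFinM; move=> ->.
- apply: eq_integral => y _; rewrite F'E -EFinM; congr EFin.
  by rewrite /GRing.mul/= -/(GRing.mul _ _) -mulrA normal_pdf_affine.
- by move=> x y xy; rewrite /F ltrD2l ltr_pM2l.
- by rewrite F'E => ?; exact: cvg_cst.
- by rewrite F'E; exact: is_cvg_cst.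
- by rewrite F'E; exact: is_cvg_cst.
- by move=> x; have [] := dF x.
- apply: (cvg_comp (fun y => s * y) (fun r => m + r)); last exact: cvg_addrl_Ny.
  by apply: gt0_cvgMrNy => //; exact: cvg_id.
- apply: (cvg_comp (fun y => s * y) (fun r => m + r)); last exact: cvg_addrl.
  by apply: gt0_cvgMry => //; exact: cvg_id.
- move=> x; apply: continuousM; first exact: cf.
  by apply: continuous_normal_pdf; rewrite gt_eqF.
- by move=> x; rewrite mulr_ge0 ?normal_pdf_ge0.
Qed.

(** The joint density of a standard [y] and of [t = x + a y + b z] factored in both ways: the law of
    [y] times that of [t] given [y], and the law of [t], with variance [c ^+ 2], times that of [y]
    given [t]. The exponents agree by completing the square. *)
Lemma normal_pdf_rotation (x a b c t y : R) : 0 < b -> 0 < c ->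
  a ^+ 2 + b ^+ 2 = c ^+ 2 ->
  normal_pdf (x + a * y) b t * normal_pdf 0 1 y =
  normal_pdf x c t * normal_pdf (a * (t - x) / c ^+ 2) (b / c) y.
Proof.
move=> b0 c0 abc; have bc0 : 0 < b / c by rewrite divr_gt0.
have bn : b != 0 by rewrite gt_eqF.
have cn : c != 0 by rewrite gt_eqF.
rewrite !normal_pdfE ?oner_eq0 ?(gt_eqF b0) ?(gt_eqF c0) ?(gt_eqF bc0)//.
rewrite mulrACA [RHS]mulrACA; congr (_ * _).
  have peakE (s : R) : 0 < s -> normal_peak s = normal_peak 1 / s.
    by move=> s0; rewrite -(normal_peakM s0) mulfK// gt_eqF.
  by rewrite (peakE b)// (peakE c)// (peakE (b / c))//; field; apply/andP; split.
rewrite /normal_fun -!expRD; congr expR.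
have -> : a ^+ 2 = c ^+ 2 - b ^+ 2 -> - (t - (x + a * y)) ^+ 2 / (b ^+ 2 *+ 2) +
  - (y - 0) ^+ 2 / (1 ^+ 2 *+ 2) =
  - ((t - x) ^+ 2 - 2 * a * (t - x) * y + a ^+ 2 * y ^+ 2 + b ^+ 2 * y ^+ 2)
    / (b ^+ 2 *+ 2) by move=> _; field.
  have -> : - (t - x) ^+ 2 / (c ^+ 2 *+ 2) +
    - (y - a * (t - x) / c ^+ 2) ^+ 2 / ((b / c) ^+ 2 *+ 2) =
    - ((t - x) ^+ 2 * (b ^+ 2 + a ^+ 2) / c ^+ 2  + c ^+ 2 * y ^+ 2
       - 2 * a * (t - x) * y) / (b ^+ 2 *+ 2) by field; apply/andP; split.
  by rewrite (addrC (b ^+ 2)) abc -abc; field; rewrite abc bn expf_neq0.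
by rewrite -abc addrK.
Qed.

(** Once the two integrals are exchanged, the inner one is that of the conditional density of [y]
    given [t], which is 1. Nonnegativity of [f] lets Tonelli's theorem apply without integrability
    conditions. *)
Lemma gauss_rotation (x a b c : R) (f : R -> R) : 0 < b -> 0 < c ->
  a ^+ 2 + b ^+ 2 = c ^+ 2 -> continuous f -> (forall x, 0 <= f x) ->
  (\int[gauss]_y \int[gauss]_z (f (x + a * y + b * z)%R)%:E =
   \int[gauss]_y (f (x + c * y)%R)%:E)%E.
Proof.
move=> b0 c0 abc cf f0.
have mf : measurable_fun setT (fun x => (f x)%:E).
  by apply/measurable_EFinP; exact: continuous_measurable_fun.
have f0' z : (0 <= (f z)%:E)%E by rewrite lee_fin.
have mjoint : measurable_fun setT
    (fun p : R * R => (f p.2 * normal_pdf (x + a * p.1) b p.2)%:E).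
  apply/measurable_EFinP; apply: measurable_funM.
    by apply: measurableT_comp => //; exact/measurable_EFinP.
  rewrite /normal_pdf gt_eqF//; apply: measurable_funM => //.
  apply: measurableT_comp => //; apply: measurable_funM => //.
  apply: measurableT_comp => //; apply: measurable_funX.
  apply: measurable_funB => //; apply: measurable_funD => //.
  exact: measurable_funM.
pose g y := (\int[leb]_t (f t * normal_pdf (x + a * y) b t)%:E)%E.
have gE y : (\int[gauss]_z (f (x + a * y + b * z)%R)%:E)%E = g y.
  rewrite -(integral_normal_prob_affine _ b0 cf f0) ge0_integral_normal_prob//.
have hE : (\int[gauss]_y (f (x + c * y)%R)%:E =
    \int[leb]_t (f t * normal_pdf x c t)%:E)%E.
  rewrite -(integral_normal_prob_affine _ c0 cf f0) ge0_integral_normal_prob//.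
rewrite hE; transitivity (\int[gauss]_y g y)%E.
  by apply: eq_integral => y _; exact: gE.
rewrite (@ge0_integral_normal_prob 0 1 g); last 2 first.
- by move=> y; apply: integral_ge0 => t _; rewrite lee_fin mulr_ge0 ?normal_pdf_ge0.
- apply: (measurable_fun_fubini_tonelli_F (m2 := leb) _ mjoint) => p.
  by rewrite lee_fin mulr_ge0 ?normal_pdf_ge0.
rewrite /g.
under eq_integral => y _.
  rewrite -ge0_integralZr//; last 3 first.
  - by apply/measurable_EFinP; apply: measurable_funM; [exact/measurable_EFinP|
      exact: measurable_normal_pdf].
  - by move=> t _; rewrite lee_fin mulr_ge0 ?normal_pdf_ge0.
  - by rewrite lee_fin normal_pdf_ge0.
  under eq_integral do rewrite -EFinM -mulrA (normal_pdf_rotation _ _ _ b0 c0 abc).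
  over.
rewrite (@fubini_tonelli _ _ _ _ _ leb leb (fun p => (f p.2 * (normal_pdf x c p.2 *
   normal_pdf (a * (p.2 - x) / c ^+ 2) (b / c) p.1))%:E))//=.
- apply: eq_integral => t _.
  under eq_integral do rewrite mulrA EFinM.
  rewrite ge0_integralZl//; last 3 first.
  - by apply/measurable_EFinP; exact: measurable_normal_pdf.
  - by move=> y _; rewrite lee_fin normal_pdf_ge0.
  - by rewrite lee_fin mulr_ge0 ?normal_pdf_ge0.
  by rewrite integral_normal_pdf mule1 EFinM.
- apply/measurable_EFinP.
  under eq_fun do rewrite -(normal_pdf_rotation _ _ _ b0 c0 abc) mulrA.
  apply: measurable_funM; first exact/measurable_EFinP.
  by apply: measurableT_comp => //; exact: measurable_normal_pdf.
- by move=> p; rewrite lee_fin !mulr_ge0 ?normal_pdf_ge0.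
Qed.

End Gauss.

(** * Mean, variance and integrability of the standard Gaussian *)

Section GaussMoments.
Context {R : realType}.
Local Notation leb := (@lebesgue_measure R).
Local Notation gauss := (@normal_prob R 0 1).

(** Gaussian integrals are read off from the total mass 1 of another normal density instead of being
    computed; a change of scale and a shift of the mean supply the tilts used below. *)
Lemma gauss_integral_tilt (g : R -> R) (c m s : R) :
  (forall x, 0 <= g x) -> measurable_fun setT g -> 0 <= c ->
  (forall y, g y * normal_pdf 0 1 y = c * normal_pdf m s y) ->
  (\int[gauss]_y (g y)%:E = c%:E)%E.
Proof.
move=> g0 mg c0 gE.
rewrite (@ge0_integral_normal_prob R 0 1 (EFin \o g)); last 2 first.
- by move=> x; rewrite lee_fin.
- exact/measurable_EFinP.
under eq_integral do rewrite -EFinM gE EFinM.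
rewrite ge0_integralZl//; last 2 first.
- by apply/measurable_EFinP; exact: measurable_normal_pdf.
- by move=> t _; rewrite lee_fin normal_pdf_ge0.
by rewrite integral_normal_pdf mule1.
Qed.

Lemma gauss_integrable_tilt (g : R -> R) (c m s : R) :
  (forall x, 0 <= g x) -> measurable_fun setT g -> 0 <= c ->
  (forall y, g y * normal_pdf 0 1 y = c * normal_pdf m s y) ->
  gauss.-integrable setT (EFin \o g).
Proof.
move=> g0 mg c0 gE; apply/integrableP; split; first exact/measurable_EFinP.
under eq_integral do rewrite /= ger0_norm//.
by rewrite (gauss_integral_tilt g0 mg c0 gE) ltry.
Qed.

Lemma normal_pdf_tilt_scale (s y : R) : 0 < s ->
  expR (y ^+ 2 * (1 - s ^- 2) / 2) * normal_pdf 0 1 y = s * normal_pdf 0 s y.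
Proof.
move=> s0; have sn : s != 0 by rewrite gt_eqF.
rewrite !normal_pdfE ?oner_eq0// -(normal_peakM s0) mulrCA [RHS]mulrA.
rewrite [s * _]mulrC; congr (_ * _); rewrite /normal_fun -expRD; congr expR.
by field.
Qed.

Lemma normal_pdf_tilt_shift (h y : R) :
  expR (h * y - h ^+ 2 / 2) * normal_pdf 0 1 y = 1 * normal_pdf h 1 y.
Proof.
rewrite !normal_pdfE ?oner_eq0// mulrCA mul1r; congr (_ * _).
by rewrite /normal_fun -expRD; congr expR; field.
Qed.

(** The scale tilt with [s] the square root of 2 makes [expR (y ^+ 2 / 4)] integrable; squaring
    [1 + y ^+ 2 / 8 <= expR (y ^+ 2 / 8)] shows that 64 times it dominates [y ^+ 4]. *)
Lemma gauss_integrable4 : gauss.-integrable setT (fun y => (y ^+ 4)%:E).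
Proof.
have r2 : (0 : R) < Num.sqrt 2 by rewrite sqrtr_gt0.
have mg : measurable_fun setT
    (fun y : R => expR (y ^+ 2 * (1 - Num.sqrt 2 ^- 2) / 2)).
  apply: measurableT_comp => //; apply: measurable_funM => //.
  by apply: measurable_funM => //; exact: exprn_measurable.
have ir := gauss_integrable_tilt (fun=> expR_ge0 _) mg (ltW r2)
  (fun y => normal_pdf_tilt_scale y r2).
apply: le_integrable (integrableZl measurableT 64 ir) => //.
- by apply/measurable_EFinP; exact: exprn_measurable.
- move=> y _; rewrite -EFinM /= lee_fin sqr_sqrtr//.
  rewrite ger0_norm; last by rewrite (exprM _ 2 2) sqr_ge0.
  rewrite ger0_norm ?mulr_ge0 ?expR_ge0//.
  rewrite (_ : y ^+ 2 * _ / 2 = y ^+ 2 / 8 + y ^+ 2 / 8); last by field.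
  rewrite expRD; have := expR_ge1Dx (y ^+ 2 / 8); move: (expR _) => e.
  have : 0 <= y ^+ 2 by rewrite sqr_ge0.
  rewrite (exprM y 2 2); move: (y ^+ 2) => z; nra.
Qed.

Lemma gauss_integrableX (k : nat) : (k <= 4)%N ->
  gauss.-integrable setT (fun y => (`|y| ^+ k)%:E).
Proof.
move=> k4; have i1 : gauss.-integrable setT (fun y => 1%:E + (y ^+ 4)%:E)%E.
  apply: integrableD => //; last exact: gauss_integrable4.
  exact: finite_measure_integrable_cst.
apply: le_integrable i1 => //.
- apply/measurable_EFinP; apply: measurable_funX.
  by apply: measurableT_comp => //; exact: normr_measurable.
- move=> y _; rewrite -EFinD /= lee_fin.
  have y4 : 0 <= y ^+ 4 by rewrite (exprM _ 2 2) sqr_ge0.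
  rewrite (ger0_norm (exprn_ge0 k _))// (ger0_norm (addr_ge0 ler01 y4)).
  have [y1|y1] := lerP `|y| 1.
    by rewrite (le_trans (exprn_ile1 k _ y1))// lerDl.
  have yk : `|y| ^+ k <= `|y| ^+ 4 by rewrite ler_weXn2l// ltW.
  by rewrite (le_trans yk)// -normrX ger0_norm// lerDr.
Qed.

Lemma gauss_integrable1 : gauss.-integrable setT (fun y => y%:E).
Proof.
apply: le_integrable (gauss_integrableX (isT : 1 <= 4)%N) => //.
  exact/measurable_EFinP.
by move=> y _; rewrite expr1 /= normr_id.
Qed.

Lemma gauss_integrable2 : gauss.-integrable setT (fun y => (y ^+ 2)%:E).
Proof.
have := gauss_integrableX (isT : 2 <= 4)%N; apply: eq_integrable => // y _.
by rewrite real_normK ?num_real.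
Qed.

(* The tilt [expR (h * y - h ^+ 2 / 2)] has Gaussian integral 1 and dominates
   [1 + h * y - h ^+ 2 / 2]; varying [h] forces the mean to vanish. *)
Lemma gauss_mean : \int[gauss]_y y = 0.
Proof.
set m := \int[gauss]_y y.
suff H (h : R) : h * m <= h ^+ 2 / 2.
  have [m0|m0|//] := ltrgtP m 0.
    by have := H m; have := H (- m); nra.
  by have := H m; nra.
have mg : measurable_fun setT (fun y : R => expR (h * y - h ^+ 2 / 2)).
  by apply: measurableT_comp => //; apply: measurable_funB.
have tilt := normal_pdf_tilt_shift h.
have e := gauss_integral_tilt (fun=> expR_ge0 _) mg ler01 tilt.
have ie := gauss_integrable_tilt (fun=> expR_ge0 _) mg ler01 tilt.
have ihy : gauss.-integrable setT (EFin \o (fun y => h * y)).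
  by apply: (integrableZl measurableT h) gauss_integrable1.
have ic c : gauss.-integrable setT (EFin \o (fun=> c)).
  exact: finite_measure_integrable_cst.
have : \int[gauss]_y (h * y + (1 - h ^+ 2 / 2)) <=
       \int[gauss]_y (expR (h * y - h ^+ 2 / 2)).
  apply: le_Rintegral => //; first exact: integrable_EFinD.
  by move=> y _; rewrite (le_trans _ (expR_ge1Dx _))//; lra.
rewrite RintegralD// RintegralZl//; last exact: gauss_integrable1.
rewrite Rintegral_prob_cst -/m.
by rewrite /Rintegral e/=; lra.
Qed.

(* Likewise [expR (y ^+ 2 * (1 - s ^- 2) / 2)] has integral [s]; comparing with
   its linear lower bound for [s] on both sides of 1 pins down the variance. *)
Lemma gauss_var : \int[gauss]_y (y ^+ 2) = 1.
Proof.
set m := \int[gauss]_y (y ^+ 2).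
have m0 : 0 <= m by apply: Rintegral_ge0 => y _; exact: sqr_ge0.
have H (s : R) : 0 < s -> 1 + (1 - s ^- 2) / 2 * m <= s.
  move=> s0; set k := (1 - s ^- 2) / 2.
  have mg : measurable_fun setT (fun y : R => expR (y ^+ 2 * (1 - s ^- 2) / 2)).
    apply: measurableT_comp => //; apply: measurable_funM => //.
    by apply: measurable_funM => //; exact: exprn_measurable.
  have tilt := fun y => normal_pdf_tilt_scale y s0.
  have e := gauss_integral_tilt (fun=> expR_ge0 _) mg (ltW s0) tilt.
  have ie := gauss_integrable_tilt (fun=> expR_ge0 _) mg (ltW s0) tilt.
  have iky : gauss.-integrable setT (EFin \o (fun y => k * y ^+ 2)).
    by apply: (integrableZl measurableT k) gauss_integrable2.
  have ic c : gauss.-integrable setT (EFin \o (fun=> c)).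
    exact: finite_measure_integrable_cst.
  have : \int[gauss]_y (1 + k * y ^+ 2) <=
         \int[gauss]_y (expR (y ^+ 2 * (1 - s ^- 2) / 2)).
    apply: le_Rintegral => //; first exact: integrable_EFinD.
    move=> y _; rewrite (le_trans _ (expR_ge1Dx _))// lerD2l.
    by rewrite /k mulrC mulrA.
  rewrite RintegralD// RintegralZl//; last exact: gauss_integrable2.
  rewrite Rintegral_prob_cst -/m.
  by rewrite /Rintegral e.
(* Multiplied by [2 * s ^+ 2], the inequality bounds [m] by [2 * s ^+ 2 / (s + 1)], from above when
   [s > 1] and from below when [s < 1]; the bound tends to 1 with [s]. *)
have {}H (s : R) : 0 < s -> 0 <= (s - 1) * (2 * s ^+ 2 - (s + 1) * m).
  move=> s0; have := H s s0; rewrite -subr_ge0 => le0.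
  have := mulr_ge0 le0 (ltW (exprn_gt0 2 s0)).
  rewrite (_ : (_ - _) * s ^+ 2 = (s - 1) * (2 * s ^+ 2 - (s + 1) * m) / 2); last first.
    by field; rewrite gt_eqF.
  lra.
have [m1|m1|//] := ltrgtP m 1.
  (* If [m < 1], a step [t] of a quarter of the gap to the left of 1 already violates the bound: the
     second factor becomes [5 t - 2 t ^+ 2], which is positive. *)
  pose t := (1 - m) / 4; have t0 : 0 < t by rewrite /t; lra.
  have t1 : t <= 4^-1 by rewrite /t; lra.
  have := H (1 - t); rewrite (_ : 1 - t - 1 = - t); last by ring.
  rewrite nmulr_rge0 ?oppr_lt0// (_ : m = 1 - 4 * t); last by rewrite /t; field.
  nra.
pose t := Num.min ((m - 1) / 4) 1.
have t0 : 0 < t by rewrite lt_min ltr01 andbT; lra.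
have t1 : t <= 1 by rewrite ge_min lexx orbT.
have tm : 1 + 4 * t <= m.
  by have : t <= (m - 1) / 4; [rewrite ge_min lexx|lra].
have := H (1 + t); rewrite (_ : 1 + t - 1 = t); last by ring.
rewrite pmulr_rge0//; nra.
Qed.

End GaussMoments.

(** * Gaussian smoothing operators *)

Section GaussSmooth.
Context {R : realType}.
Local Notation gauss := (@normal_prob R 0 1).

Lemma bounded_lip_continuous (M : R) f : bounded_lip M f -> continuous f.
Proof.
move=> bf; have M0 := bounded_lip_ge0 bf; case: bf => _ fL x.
apply/cvgrPdist_le => e e0; have M1 : 0 < M + 1 by lra.
near=> y; rewrite (le_trans (fL x y))//.
have : `|x - y| <= e / (M + 1).
  near: y; apply: cvgr_dist_le; [exact: cvg_id|exact: divr_gt0].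
rewrite ler_pdivlMr// => h; rewrite (le_trans _ h)// mulrC ler_wpM2l//; lra.
Unshelve. all: by end_near. Qed.

Lemma bounded_lip_measurable (M : R) f : bounded_lip M f -> measurable_fun setT f.
Proof. by move/bounded_lip_continuous/continuous_measurable_fun. Qed.

Definition gauss_smooth (s : R) (f : R -> R) (x : R) : R :=
  \int[gauss]_y (f (x + s * y)).

Lemma integrable_gauss_shift (M : R) f (s x : R) : bounded_lip M f ->
  gauss.-integrable setT (EFin \o (fun y => f (x + s * y))).
Proof.
move=> bf; apply: (@integrable_EFin_bounded _ _ _ _ M).
  apply: measurableT_comp; first exact: bounded_lip_measurable bf.
  by apply: measurable_funD => //; apply: measurable_funM.
by move=> y; have [+ _] := bf; exact.
Qed.

Lemma bounded_lip_gauss_smooth (M s : R) f : bounded_lip M f ->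
  bounded_lip M (gauss_smooth s f).
Proof.
move=> bf; have M0 := bounded_lip_ge0 bf; have i x := integrable_gauss_shift s x bf.
case: bf => fM fL; split => [x|x y].
  have := @Rintegral_close _ _ _ gauss _ _ M (i x) (integrable_EFin_cst gauss 0).
  by rewrite Rintegral_prob_cst subr0; apply=> y; rewrite subr0.
rewrite Rintegral_close// => z; rewrite (le_trans (fL _ _))//.
by rewrite opprD addrACA subrr addr0.
Qed.

(** The Taylor inequality is linear in the triple of functions, so averaging its translates against
    a probability preserves it with the same [M]. This is what keeps the replacement errors uniform
    over the iterations. *)
Lemma smooth3_gauss_smooth (M s : R) f f1 f2 : smooth3 M f f1 f2 ->
  smooth3 M (gauss_smooth s f) (gauss_smooth s f1) (gauss_smooth s f2).
Proof.
move=> [b b1 b2 t]; split; try exact: bounded_lip_gauss_smooth.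
move=> x h; have i x := integrable_gauss_shift s x b.
have i1 := integrable_gauss_shift s x b1; have i2 := integrable_gauss_shift s x b2.
have j1 := integrable_EFinZ h i1; have j2 := integrable_EFinZ (h ^+ 2 / 2) i2.
have e : gauss_smooth s f (x + h) - gauss_smooth s f x - gauss_smooth s f1 x * h
    - gauss_smooth s f2 x * h ^+ 2 / 2 =
  \int[gauss]_y (f (x + h + s * y)) - \int[gauss]_y (f (x + s * y) +
     h * f1 (x + s * y) + h ^+ 2 / 2 * f2 (x + s * y)).
  rewrite RintegralD//; last exact: integrable_EFinD.
  rewrite RintegralD// !RintegralZl// /gauss_smooth; ring.
rewrite e Rintegral_close//; first by do 2 apply: integrable_EFinD => //.
move=> y; have := t (x + s * y) h; rewrite (addrAC x).
apply: le_trans; rewrite le_eqVlt; apply/orP; left; apply/eqP; congr (`|_|).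
by ring.
Qed.

(** The Taylor inequality at increment [s * y] is integrated in [y]: mean 0 removes the first order
    term and variance 1 leaves [s ^+ 2 / 2] in front of [f2]. *)
Lemma gauss_smooth_taylor (M s : R) f f1 f2 x : smooth3 M f f1 f2 ->
  `|gauss_smooth s f x - (f x + s ^+ 2 / 2 * f2 x)| <=
    M * `|s| ^+ 3 * \int[gauss]_y (`|y| ^+ 3).
Proof.
move=> [b b1 b2 t]; have i := integrable_gauss_shift s x b.
have g1 := @gauss_integrable1 R; have g2 := @gauss_integrable2 R.
have g3 : gauss.-integrable setT (EFin \o (fun y => `|y| ^+ 3)).
  exact: gauss_integrableX.
have j1 := integrable_EFinZ (f1 x * s) g1.
have j2 := integrable_EFinZ (f2 x * s ^+ 2 / 2) g2.
have jc := integrable_EFin_cst gauss (f x).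
have -> : f x + s ^+ 2 / 2 * f2 x =
    \int[gauss]_y (f x + f1 x * s * y + f2 x * s ^+ 2 / 2 * y ^+ 2).
  rewrite RintegralD//; last exact: integrable_EFinD.
  rewrite RintegralD// !RintegralZl// Rintegral_prob_cst gauss_mean gauss_var.
  by field.
rewrite -RintegralB//; last by do 2 apply: integrable_EFinD => //.
have k := integrable_EFinB i (integrable_EFinD (integrable_EFinD jc j1) j2).
rewrite (le_trans (le_normr_Rintegral measurableT k))// -RintegralZl//.
apply: le_Rintegral => //; first exact: integrable_EFin_norm.
  exact: integrable_EFinZ.
move=> y _; have := t x (s * y); rewrite normrM !exprMn (mulrA M).
apply: le_trans; rewrite le_eqVlt; apply/orP; left; apply/eqP; congr (`|_|).
by field.
Qed.

Lemma gauss_smooth0 f : gauss_smooth 0 f = f.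
Proof.
apply/funext => x; rewrite /gauss_smooth.
under eq_Rintegral do rewrite mul0r addr0.
exact: Rintegral_prob_cst.
Qed.

Lemma EFin_gauss_smooth (M s : R) f x : bounded_lip M f ->
  (gauss_smooth s f x)%:E = (\int[gauss]_y (f (x + s * y)%R)%:E)%E.
Proof.
move=> bf; rewrite /gauss_smooth /Rintegral fineK//.
by apply: integrable_fin_num => //; exact: integrable_gauss_shift bf.
Qed.

Lemma gauss_smooth_comp (M a b : R) f : bounded_lip M f -> (forall x, 0 <= f x) ->
  0 < b -> gauss_smooth a (gauss_smooth b f) =
           gauss_smooth (Num.sqrt (a ^+ 2 + b ^+ 2)) f.
Proof.
move=> bf f0 b0; apply/funext => x; apply: EFin_inj.
have b2 : 0 < b ^+ 2 by rewrite exprn_gt0.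
have a2 : 0 <= a ^+ 2 by rewrite sqr_ge0.
rewrite (EFin_gauss_smooth _ _ (bounded_lip_gauss_smooth b bf)).
rewrite (EFin_gauss_smooth _ _ bf) -(@gauss_rotation R x a b (Num.sqrt (a ^+ 2 + b ^+ 2)) f)//.
- by apply: eq_integral => y _; rewrite (EFin_gauss_smooth _ _ bf).
- by rewrite sqrtr_gt0; lra.
- by rewrite sqr_sqrtr//; lra.
- exact: bounded_lip_continuous bf.
Qed.

(** Stability of the Gaussian law: variances add under composition. At step size [1 / sqrt n] the
    n-fold iterate is the standard Gaussian average, with no error term. *)
Lemma iter_gauss_smooth (M s : R) f n : bounded_lip M f -> (forall x, 0 <= f x) ->
  0 < s -> iter n (gauss_smooth s) f = gauss_smooth (Num.sqrt n%:R * s) f.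
Proof.
move=> bf f0 s0; elim: n => [|[|n] IH].
(* The composition lemma requires a positive inner scale, which the empty iterate lacks; the genuine
   induction therefore starts at one smoothing. *)
- by rewrite sqrtr0 mul0r gauss_smooth0.
- by rewrite /= sqrtr1 mul1r.
- have b0 : 0 < Num.sqrt n.+1%:R * s by rewrite mulr_gt0// sqrtr_gt0 ltr0n.
  rewrite iterS IH (gauss_smooth_comp _ bf f0 b0).
  apply: (f_equal (fun c => gauss_smooth c f)); rewrite exprMn sqr_sqrtr//.
  rewrite -{1}[s ^+ 2]mul1r -mulrDl sqrtrM; last by rewrite -nat1r addr_ge0.
  by rewrite sqrtr_sqr gtr0_norm// -nat1r.
Qed.

End GaussSmooth.

(** * Independence *)

Section Rectangles.
Context {d1 d2} {T1 : measurableType d1} {T2 : measurableType d2} {R : realType}.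

(** Rectangles are stable under intersection and generate the product sigma-algebra. *)
Lemma eq_measure_rectangles (m1 m2 : {measure set (T1 * T2) -> \bar R}) :
  (forall A B, measurable A -> measurable B -> m1 (A `*` B) = m2 (A `*` B)) ->
  (m1 setT < +oo)%E -> forall D, measurable D -> m1 D = m2 D.
Proof.
move=> m12 m1oo D mD.
pose C := [set A `*` B | A in @measurable _ T1 & B in @measurable _ T2].
apply: (measure_unique C (fun=> setT)) => //.
- exact: measurable_prod_measurableType.
- move=> _ _ [A1 mA1 [B1 mB1 <-]] [A2 mA2 [B2 mB2 <-]]; rewrite -setXI.
  exists (A1 `&` A2); first exact: measurableI.
  by exists (B1 `&` B2) => //; exact: measurableI.
- by move=> _; exists setT => //; exists setT => //; rewrite setXTT.
- by rewrite bigcup_const.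
- by move=> _ [A mA [B mB <-]]; exact: m12.
Qed.

End Rectangles.

Section Independence.
Context {d} {Omega : measurableType d} {R : realType} (P : probability Omega R).

Lemma measurable_preimage {d'} {T : measurableType d'} (X : Omega -> T) A :
  measurable_fun setT X -> measurable A -> measurable (X @^-1` A).
Proof. by move=> mX mA; rewrite -[_ @^-1` _]setTI; exact: mX. Qed.

Lemma same_law_comp {d1 d2} {T1 : measurableType d1} {T2 : measurableType d2}
    (X X' : Omega -> T1) (h : T1 -> T2) : measurable_fun setT h ->
  same_law P X X' -> same_law P (h \o X) (h \o X').
Proof.
by move=> mh XX' A mA; apply: (XX' (h @^-1` A)); rewrite -[_ @^-1` _]setTI; exact: mh.
Qed.

Lemma same_law_integrable (X X' : Omega -> R) :
  measurable_fun setT X -> measurable_fun setT X' -> same_law P X X' ->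
  P.-integrable setT (EFin \o X) -> P.-integrable setT (EFin \o X').
Proof.
move=> mX mX' XX' /integrableP[_ iX]; apply/integrableP; split.
  exact/measurable_EFinP.
apply: le_lt_trans iX.
pose Y : {mfun Omega >-> R} := mfun_Sub (mem_set mX).
pose Y' : {mfun Omega >-> R} := mfun_Sub (mem_set mX').
have mabs : measurable_fun setT (fun x : R => `|x|%:E).
  by apply/measurable_EFinP; exact: normr_measurable.
have e0 x : (0 <= `|x : R|%:E)%E by rewrite lee_fin.
have := ge0_integral_distribution Y mabs e0.
have := ge0_integral_distribution Y' mabs e0.
rewrite /comp/= => <- <-; rewrite le_eqVlt; apply/orP; left; apply/eqP.
by apply: eq_measure_integral => A mA _; first [exact: XX' | exact/esym/XX'].
Qed.

Lemma same_law_Rintegral (X X' : Omega -> R) :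
  measurable_fun setT X' -> same_law P X X' ->
  P.-integrable setT (EFin \o X) -> \int[P]_o X o = \int[P]_o X' o.
Proof.
move=> mX' XX' iX; have mX := integrable_EFin_measurable iX.
have iX' := same_law_integrable mX mX' XX' iX.
pose Y : {mfun Omega >-> R} := mfun_Sub (mem_set mX).
pose Y' : {mfun Omega >-> R} := mfun_Sub (mem_set mX').
have mE : measurable_fun setT (@EFin R) by exact: EFin_measurable.
have := @integral_distribution _ _ _ _ _ P Y (@EFin R) mE iX.
have := @integral_distribution _ _ _ _ _ P Y' (@EFin R) mE iX'.
rewrite /Rintegral /comp/= => <- <-; congr fine.
by apply: eq_measure_integral => A mA _; first [exact: XX' | exact/esym/XX'].
Qed.

Lemma independent_pair_comp {d1 d2 d3 d4} {T1 : measurableType d1}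
    {T2 : measurableType d2} {T3 : measurableType d3} {T4 : measurableType d4}
    (X : Omega -> T1) (Y : Omega -> T2) (f : T1 -> T3) (g : T2 -> T4) :
  measurable_fun setT f -> measurable_fun setT g ->
  independent_pair P X Y -> independent_pair P (f \o X) (g \o Y).
Proof.
move=> mf mg XY A B mA mB.
by apply: (XY (f @^-1` A) (g @^-1` B)); rewrite -[_ @^-1` _]setTI; [exact: mf|exact: mg].
Qed.

(** Independence makes the joint law the product of the marginal laws; Tonelli's theorem then gives
    integrability of the product and Fubini's theorem its value. *)
Lemma independent_mul (X Y : Omega -> R) : independent_pair P X Y ->
  P.-integrable setT (EFin \o X) -> P.-integrable setT (EFin \o Y) ->
  P.-integrable setT (EFin \o (fun o => X o * Y o)) /\
  \int[P]_o (X o * Y o) = (\int[P]_o X o) * (\int[P]_o Y o).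
Proof.
move=> XY iX iY; have mX := integrable_EFin_measurable iX.
have mY := integrable_EFin_measurable iY.
pose X' : {mfun Omega >-> R} := mfun_Sub (mem_set mX).
pose Y' : {mfun Omega >-> R} := mfun_Sub (mem_set mY).
have mJ := measurable_fun_pair mX mY.
pose J : {mfun Omega >-> (R * R)%type} := mfun_Sub (mem_set mJ).
pose m := (distribution P X' \x distribution P Y')%E.
have mD D : measurable D -> m D = distribution P J D.
  by move=> ?; apply: product_measure_unique => // A B mA mB; exact: XY.
have mmul : measurable_fun setT (fun p : R * R => (p.1 * p.2)%:E).
  by apply/measurable_EFinP; exact: measurable_funM.
have iXd : (distribution P X').-integrable setT (@EFin R).
  by apply: integrable_pushforward => //.
have iYd : (distribution P Y').-integrable setT (@EFin R).
  by apply: integrable_pushforward => //.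
have im : m.-integrable setT (fun p : R * R => (p.1 * p.2)%:E).
  apply/integrable12ltyP => //.
  have mabs : measurable_fun setT (fun x : R => `|x|%:E).
    by apply/measurable_EFinP; exact: normr_measurable.
  have inner (x : R) : (\int[distribution P Y']_y `|(x * y)%:E| =
      `|x|%:E * \int[distribution P Y']_y `|y|%:E)%E.
    under eq_integral do rewrite /= normrM EFinM.
    by rewrite ge0_integralZl.
  under eq_integral => x _ do rewrite inner.
  rewrite ge0_integralZr//; last exact: integral_ge0.
  have /integrableP[_ iX2] := iXd; have /integrableP[_ iY2] := iYd.
  apply: lte_mul_pinfty => //; first exact: integral_ge0.
  by rewrite ge0_fin_numE//; exact: integral_ge0.
have ge0mul p : (0 <= `|(p.1 * p.2 : R)%:E|)%E by exact: abse_ge0.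
have iXY : P.-integrable setT (EFin \o (fun o => X o * Y o)).
  apply/integrableP; split.
    by apply/measurable_EFinP; exact: measurable_funM.
  have /integrableP[_] := im; apply: le_lt_trans.
  have mmula : measurable_fun setT (fun p : R * R => `|(p.1 * p.2)%:E|%E).
    exact: measurableT_comp.
  have := ge0_integral_distribution J mmula ge0mul; rewrite /comp /= => <-.
  rewrite le_eqVlt; apply/orP; left; apply/eqP/esym.
  by apply: eq_measure_integral => A mA _; exact: mD.
split=> //; rewrite /Rintegral.
have := @integral_distribution _ _ _ _ _ P J _ mmul iXY; rewrite /comp /= => <-.
transitivity (fine (\int[m]_z (z.1 * z.2)%:E)).
  by congr fine; apply: eq_measure_integral => A mA _; exact/esym/mD.
rewrite -integral12_prod_meas1// /fubini_F/=.
have mE : measurable_fun setT (@EFin R) by exact: EFin_measurable.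
have eX := @integral_distribution _ _ _ _ _ P X' (@EFin R) mE iX.
have eY : (\int[distribution P Y']_y y%:E = (\int[P]_o Y o)%:E)%E.
  have := @integral_distribution _ _ _ _ _ P Y' (@EFin R) mE iY.
  by rewrite /comp /= => ->; rewrite fineK//; exact: integrable_fin_num.
have inner (x : R) : (\int[distribution P Y']_y (x * y)%:E =
    x%:E * (\int[P]_o Y o)%:E)%E.
  under eq_integral do rewrite EFinM.
  by rewrite integralZl// eY.
under eq_integral => x _ do rewrite inner.
rewrite integralZr// fineM//; last exact: integrable_fin_num.
by rewrite eX.
Qed.

End Independence.

(** * Partial sums of independent variables *)

Section PartialSums.
Context {d} {Omega : measurableType d} {R : realType} (P : probability Omega R).

(** Both sides are finite measures in [D]: the image under the pair of [P] restricted to [E], and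
    the law of the pair scaled by [P E]. By assumption they agree on rectangles. *)
Lemma joint_event_independent (S X : Omega -> R) (E : set Omega) :
  measurable_fun setT S -> measurable_fun setT X -> measurable E ->
  (forall A B, measurable A -> measurable B ->
    P (S @^-1` A `&` X @^-1` B `&` E) = (P (S @^-1` A `&` X @^-1` B) * P E)%E) ->
  forall D : set (R * R), measurable D ->
    P ((fun o => (S o, X o)) @^-1` D `&` E) =
    (P ((fun o => (S o, X o)) @^-1` D) * P E)%E.
Proof.
move=> mS mX mE SXE D mD; have mJ := measurable_fun_pair mS mX.
pose J : {mfun Omega >-> (R * R)%type} := mfun_Sub (mem_set mJ).
have PE0 : 0 <= fine (P E) by rewrite fine_ge0.
pose m1 : {measure set (R * R) -> \bar R} :=
  measure_function_pushforward__canonical__measure_function_Measure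
    (mrestr P mE) mJ.
pose m2 : {measure set (R * R) -> \bar R} :=
  mscale (NngNum PE0) (distribution P J).
have m2E A : m2 A = (P (J @^-1` A) * P E)%E.
  by rewrite /m2 /= /mscale /= fineK ?fin_num_measure// muleC.
rewrite -(m2E D); apply: (@eq_measure_rectangles _ _ _ _ _ m1 m2) => //.
  by move=> A B mA mB; rewrite m2E; exact: SXE.
rewrite /m1 /= /pushforward /mrestr.
by rewrite ltey_eq fin_num_measure// setTI.
Qed.

Variable eta : nat -> Omega -> R.
Hypothesis meta : forall s, measurable_fun setT (eta s).
Hypothesis ieta : mutually_independent P eta.

Definition partial_sum (n : nat) (o : Omega) : R := \sum_(s < n) eta s o.

Lemma measurable_partial_sum n : measurable_fun setT (partial_sum n).
Proof. exact: measurable_sum. Qed.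

(* Events on later indices are carried along so that the induction step can
   split [eta k] off them. *)
Lemma partial_sum_events k (I : seq nat) (B : nat -> set R) (A : set R) :
  uniq I -> (forall i, i \in I -> (k <= i)%N) -> (forall i, measurable (B i)) ->
  measurable A ->
  P (partial_sum k @^-1` A `&` \bigcap_(i in [set` I]) (eta i @^-1` B i)) =
  (P (partial_sum k @^-1` A) * P (\bigcap_(i in [set` I]) (eta i @^-1` B i)))%E.
Proof.
elim: k I B A => [|k IH] I B A uI kI mB mA.
  (* The empty sum is the constant 0, so its event is everything or nothing. *)
  have [A0|A0] := pselect (A 0).
    have -> : partial_sum 0 @^-1` A = setT.
      by apply/seteqP; split => // o _; rewrite /= /partial_sum big_ord0.
    by rewrite setTI probability_setT mul1e.
  have -> : partial_sum 0 @^-1` A = set0.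
    by apply/seteqP; split => // o; rewrite /= /partial_sum big_ord0.
  by rewrite set0I measure0 mul0e.
set E := \bigcap_(i in [set` I]) (eta i @^-1` B i).
have mE : measurable E.
  by apply: fin_bigcap_measurable => // i _; exact: measurable_preimage.
have kNI : k \notin I by apply/negP => /kI; rewrite ltnn.
pose D := [set p : R * R | A (p.1 + p.2)].
have mD : measurable D.
  rewrite /D -[X in measurable X]setTI.
  by apply: (measurable_funD measurable_fst measurable_snd measurableT).
(* The event on the longer sum is an event on the pair formed by the shorter sum and [eta k]; it is
   thereby reduced to rectangles, on which the induction hypothesis can speak. *)
have SE : partial_sum k.+1 @^-1` A = (fun o => (partial_sum k o, eta k o)) @^-1` D.
  by apply/seteqP; split => o; rewrite /D /= /partial_sum big_ord_recr.
rewrite SE; apply: joint_event_independent => //.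
  exact: measurable_partial_sum.
move=> A1 B1 mA1 mB1.
(* The constraint on [eta k] is inserted among those on the later indices, so that the induction
   hypothesis applies to [k :: I]. *)
pose B' i := if i == k then B1 else B i.
have mB' i : measurable (B' i) by rewrite /B'; case: ifP.
have B'k : eta k @^-1` B' k = eta k @^-1` B1 by rewrite /B' eqxx.
have B'E : \bigcap_(i in [set` k :: I]) (eta i @^-1` B' i) = eta k @^-1` B1 `&` E.
  have -> : [set` k :: I] = k |` [set` I].
    apply/seteqP; split => i /=; rewrite inE => h.
      by case/orP: h => [/eqP|]; [left|right].
    by case: h => [->|->]; rewrite ?eqxx ?orbT.
  rewrite bigcap_setU1 B'k; congr (_ `&` _).
  by apply: eq_bigcapr => i iI; rewrite /B'; case: eqP => // ik; move: kNI; rewrite -ik iI.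
have Bk : \bigcap_(i in [set` [:: k]]) (eta i @^-1` B' i) = eta k @^-1` B1.
  by rewrite set_cons1 bigcap_set1.
have e1 : P (partial_sum k @^-1` A1 `&` eta k @^-1` B1 `&` E) =
    (P (partial_sum k @^-1` A1) * P (eta k @^-1` B1 `&` E))%E.
  rewrite -setIA -B'E IH//=; first by rewrite kNI.
  by move=> i; rewrite inE => /orP[/eqP ->//|/kI/ltnW].
have e2 : P (partial_sum k @^-1` A1 `&` eta k @^-1` B1) =
    (P (partial_sum k @^-1` A1) * P (eta k @^-1` B1))%E.
  by rewrite -Bk IH//= => i; rewrite inE => /eqP ->.
have e3 : P (eta k @^-1` B1 `&` E) = (P (eta k @^-1` B1) * P E)%E.
  rewrite -B'E ieta//=; last by rewrite kNI.
  rewrite big_cons B'k; congr (_ * _)%E; rewrite /E ieta//.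
  rewrite [LHS]big_seq [RHS]big_seq; apply: eq_bigr => i iI.
  by rewrite /B'; case: eqP => // ik; move: kNI; rewrite -ik iI.
by rewrite e1 e2 e3 muleA.
Qed.

Lemma partial_sum_independent k : independent_pair P (partial_sum k) (eta k).
Proof.
move=> A B mA mB.
have := @partial_sum_events k [:: k] (fun=> B) A.
by rewrite set_cons1 bigcap_set1; apply => // i; rewrite inE => /eqP ->.
Qed.

(** In the square of [partial_sum n + eta n] the cross term integrates to 0, by independence and
    centring. *)
Lemma second_moment_partial_sum (v : R) :
  (forall s, P.-integrable setT (EFin \o (fun o => eta s o ^+ 2))) ->
  (forall s, P.-integrable setT (EFin \o eta s)) ->
  (forall s, \int[P]_o eta s o = 0) -> (forall s, \int[P]_o (eta s o ^+ 2) = v) ->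
  forall n, P.-integrable setT (EFin \o (fun o => partial_sum n o ^+ 2)) /\
    \int[P]_o (partial_sum n o ^+ 2) = n%:R * v.
Proof.
move=> i2 i1 m0 mv; elim=> [|n [iS eS]].
  have e : (fun o => partial_sum 0 o ^+ 2) = fun=> 0.
    by apply/funext => o; rewrite /partial_sum big_ord0 expr0n.
  by rewrite e mul0r Rintegral_prob_cst; split => //; exact: integrable_EFin_cst.
have iSn : P.-integrable setT (EFin \o partial_sum n).
  exact: (@integrable_EFin_sum _ _ _ P _ _ (fun s : 'I_n => eta s)).
have [ip ep] := independent_mul (@partial_sum_independent n) iSn (i1 n).
have ip2 := integrable_EFinZ 2 ip.
have e : (fun o => partial_sum n.+1 o ^+ 2) = fun o =>
    partial_sum n o ^+ 2 + 2 * (partial_sum n o * eta n o) + eta n o ^+ 2.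
  by apply/funext => o; rewrite /partial_sum big_ord_recr /=; ring.
rewrite e; split; first by do 2 apply: integrable_EFinD => //.
rewrite RintegralD//; last exact: integrable_EFinD.
rewrite RintegralD// RintegralZl// ep eS m0 mv -nat1r; ring.
Qed.

End PartialSums.

(** * Central limit theorem *)

Section Lindeberg.
Context {d} {Omega : measurableType d} {R : realType} (P : probability Omega R).
Local Notation gauss := (@normal_prob R 0 1).

Lemma integrable_bounded_lip_comp (M : R) g (S : Omega -> R) :
  bounded_lip M g -> measurable_fun setT S ->
  P.-integrable setT (EFin \o (fun o => g (S o))).
Proof.
move=> bg mS; apply: (@integrable_EFin_bounded _ _ _ _ M).
  by apply: measurableT_comp => //; exact: bounded_lip_measurable bg.
by move=> o; have [+ _] := bg; exact.
Qed.

(** Both expectations are compared with that of [g (c * S) + c ^+ 2 / 2 * g2 (c * S)]. A summand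
    independent of [S] with mean 0 and variance 1 enters the second-order expansion only through
    these two moments, and so does the Gaussian one; what remains are the two third absolute
    moments. *)
Lemma lindeberg_step (M t c : R) g g1 g2 (S X : Omega -> R) :
  smooth3 M g g1 g2 -> 0 <= c -> measurable_fun setT S -> independent_pair P S X ->
  P.-integrable setT (EFin \o X) -> P.-integrable setT (EFin \o (fun o => X o ^+ 2)) ->
  P.-integrable setT (EFin \o (fun o => `|X o| ^+ 3)) ->
  \int[P]_o X o = 0 -> \int[P]_o (X o ^+ 2) = 1 ->
  \int[P]_o (`|X o| ^+ 3) <= t ->
  `|\int[P]_o (g (c * (S o + X o))) - \int[P]_o (gauss_smooth c g (c * S o))| <=
  M * c ^+ 3 * (t + \int[gauss]_y (`|y| ^+ 3)).
Proof.
move=> [b b1 b2 tay] c0 mS SX i1 i2 i3 m0 m1 m3.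
have M0 := bounded_lip_ge0 b.
have mX := integrable_EFin_measurable i1.
have mcS : measurable_fun setT (fun o => c * S o) by exact: measurable_funM.
have mcSX : measurable_fun setT (fun o => c * (S o + X o)).
  by apply: measurable_funM => //; exact: measurable_funD.
have ig := integrable_bounded_lip_comp b mcS.
have ig1 := integrable_bounded_lip_comp b1 mcS.
have ig2 := integrable_bounded_lip_comp b2 mcS.
have igX := integrable_bounded_lip_comp b mcSX.
have mgc h (k : R) : bounded_lip k h -> measurable_fun setT (fun x => h (c * x)).
  move=> bh; apply: measurableT_comp; first exact: bounded_lip_measurable bh.
  exact: measurable_funM.
have [j1 e1] := independent_mul
  (independent_pair_comp (mgc _ _ b1) (@measurable_id _ _ setT) SX) ig1 i1.
have msq : measurable_fun setT (fun x : R => x ^+ 2) by exact: exprn_measurable.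
have [j2 e2] := independent_mul (independent_pair_comp (mgc _ _ b2) msq SX) ig2 i2.
have k1 := integrable_EFinZ c j1; have k2 := integrable_EFinZ (c ^+ 2 / 2) j2.
have eT : \int[P]_o (g (c * S o) + c * (g1 (c * S o) * X o) +
      c ^+ 2 / 2 * (g2 (c * S o) * X o ^+ 2)) =
    \int[P]_o (g (c * S o) + c ^+ 2 / 2 * g2 (c * S o)).
  rewrite RintegralD//; last exact: integrable_EFinD.
  rewrite RintegralD// RintegralZl// [in X in _ + X]RintegralZl//.
  rewrite RintegralD//; last exact: integrable_EFinZ.
  rewrite [in RHS]RintegralZl//.
  by rewrite /comp /= in e1 e2; rewrite e1 e2 m0 m1 !mulr0 mulr1 addr0.
have iT := integrable_EFinD (integrable_EFinD ig k1) k2.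
have iG := integrable_bounded_lip_comp (bounded_lip_gauss_smooth c b) mcS.
have A1 : `|\int[P]_o (g (c * (S o + X o))) - \int[P]_o (g (c * S o) +
    c * (g1 (c * S o) * X o) + c ^+ 2 / 2 * (g2 (c * S o) * X o ^+ 2))| <=
    M * c ^+ 3 * t.
  rewrite -RintegralB//; have k := integrable_EFinB igX iT.
  rewrite (le_trans (le_normr_Rintegral measurableT k))//.
  rewrite (@le_trans _ _ (M * c ^+ 3 * \int[P]_o (`|X o| ^+ 3)))//; last first.
    by rewrite ler_wpM2l// mulr_ge0// exprn_ge0.
  rewrite -RintegralZl// le_Rintegral//.
  - exact: integrable_EFin_norm.
  - exact: integrable_EFinZ.
  move=> o _; have := tay (c * S o) (c * X o).
  rewrite normrM !exprMn (ger0_norm c0) (mulrA M) -mulrDr.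
  apply: le_trans; rewrite le_eqVlt; apply/orP; left; apply/eqP; congr (`|_|).
  by rewrite /=; field.
have A2 : `|\int[P]_o (g (c * S o) + c ^+ 2 / 2 * g2 (c * S o)) -
    \int[P]_o (gauss_smooth c g (c * S o))| <=
    M * c ^+ 3 * \int[gauss]_y (`|y| ^+ 3).
  rewrite Rintegral_close//; first by apply: integrable_EFinD => //; exact: integrable_EFinZ.
  move=> o; rewrite distrC.
  by have := gauss_smooth_taylor c (c * S o) (And4 b b1 b2 tay); rewrite (ger0_norm c0).
rewrite mulrDr; apply: le_trans (lerD A1 A2); rewrite eT.
exact: ler_distD.
Qed.

Variable eta : nat -> Omega -> R.
Hypothesis ieta : mutually_independent P eta.
Hypothesis i1 : forall s, P.-integrable setT (EFin \o eta s).
Hypothesis i2 : forall s, P.-integrable setT (EFin \o (fun o => eta s o ^+ 2)).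
Hypothesis i3 : forall s, P.-integrable setT (EFin \o (fun o => `|eta s o| ^+ 3)).
Hypothesis m0 : forall s, \int[P]_o eta s o = 0.
Hypothesis m1 : forall s, \int[P]_o (eta s o ^+ 2) = 1.
Variable t : R.
Hypothesis m3 : forall s, \int[P]_o (`|eta s o| ^+ 3) <= t.

(** The last summand is traded for one smoothing of [g], and the induction hypothesis is applied to
    the smoothed function, which has the same constant [M]. The point 0 is the value of the empty
    sum. *)
Lemma lindeberg_sum (M c : R) g g1 g2 k : smooth3 M g g1 g2 -> 0 <= c ->
  `|\int[P]_o (g (c * partial_sum eta k o)) - iter k (gauss_smooth c) g 0| <=
  k%:R * (M * c ^+ 3 * (t + \int[gauss]_y (`|y| ^+ 3))).
Proof.
have meta s : measurable_fun setT (eta s) by exact: integrable_EFin_measurable.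
elim: k g g1 g2 => [|k IH] g g1 g2 sg c0.
  under eq_Rintegral do rewrite /partial_sum big_ord0 mulr0.
  by rewrite Rintegral_prob_cst subrr normr0 mul0r.
have mS := measurable_partial_sum meta k.
have st := lindeberg_step sg c0 mS (partial_sum_independent meta ieta k)
  (i1 k) (i2 k) (i3 k) (m0 k) (m1 k) (m3 k).
have := IH _ _ _ (smooth3_gauss_smooth c sg) c0.
rewrite -iterSr -nat1r mulrDl mul1r => ih.
rewrite (le_trans _ (lerD st ih))//.
have -> : \int[P]_o (g (c * partial_sum eta k.+1 o)) =
    \int[P]_o (g (c * (partial_sum eta k o + eta k o))).
  by apply: eq_Rintegral => o _; rewrite /partial_sum big_ord_recr.
exact: ler_distD.
Qed.

Lemma central_limit_smooth (M : R) g g1 g2 : smooth3 M g g1 g2 ->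
  (forall x, 0 <= g x) ->
  \int[P]_o (g ((Num.sqrt n%:R)^-1 * partial_sum eta n o)) @[n --> \oo] -->
  \int[gauss]_y g y.
Proof.
move=> sg g0; have [bg _ _ _] := sg.
set C := M * (t + \int[gauss]_y (`|y| ^+ 3)).
apply/cvgrPdist_le => e e0; near=> n.
have n0 : (0 < n)%N by near: n; exact: nbhs_infty_gt.
have r0 : 0 < Num.sqrt n%:R :> R by rewrite sqrtr_gt0 ltr0n.
have c0 : 0 < (Num.sqrt n%:R)^-1 :> R by rewrite invr_gt0.
have := lindeberg_sum n sg (ltW c0).
rewrite (iter_gauss_smooth n bg g0 c0) mulfV ?gt_eqF// distrC => h.
have -> : \int[gauss]_y g y = gauss_smooth 1 g 0.
  by apply: eq_Rintegral => y _; rewrite add0r mul1r.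
apply: (le_trans h).
(* With [c = 1 / sqrt n], the n errors of order [c ^+ 3] add up to order [1 / sqrt n]. *)
have -> : n%:R * (M * (Num.sqrt n%:R)^-1 ^+ 3 * (t + \int[gauss]_y (`|y| ^+ 3))) =
    C / Num.sqrt n%:R.
  rewrite /C -{1}(sqr_sqrtr (ler0n R n)); field; rewrite gt_eqF//.
rewrite ler_pdivrMr// mulrC -ler_pdivrMr//.
have : (C / e) ^+ 2 <= n%:R by near: n; exact: nbhs_infty_ger.
move=> hn; have := ler_wsqrtr hn; rewrite sqrtr_sqr; apply: le_trans.
exact: ler_norm.
Unshelve. all: by end_near. Qed.

End Lindeberg.

(** * Quadratic forms and the statistic *)

Section QuadraticForms.
Context {R : realType}.

Definition bform k (A : 'M[R]_k) (x y : 'cV[R]_k) : R := (x^T *m A *m y) 0 0.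

Definition sqnorm k (v : 'cV[R]_k) : R := \sum_i v i 0 ^+ 2.

Lemma sqnorm_ge0 k (v : 'cV[R]_k) : 0 <= sqnorm v.
Proof. by apply: sumr_ge0 => i _; exact: sqr_ge0. Qed.

Lemma sqnormE k (v : 'cV[R]_k) : sqnorm v = (v^T *m v) 0 0.
Proof. by rewrite mxE; apply: eq_bigr => i _; rewrite mxE expr2. Qed.

Lemma bformE k (A : 'M[R]_k) x y :
  bform A x y = \sum_i \sum_j x i 0 * A i j * y j 0.
Proof.
rewrite /bform mxE exchange_big; apply: eq_bigr => j _ /=.
by rewrite mxE mulr_suml; apply: eq_bigr => i _; rewrite mxE.
Qed.

(** Each product of two coordinates is at most [sqnorm v] in absolute value. The entrywise norm is
    crude, but it is the one that the law of large numbers controls entry by entry. *)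
Lemma bform_le k (A : 'M[R]_k) v :
  `|bform A v v| <= (\sum_i \sum_j `|A i j|) * sqnorm v.
Proof.
rewrite bformE (le_trans (ler_norm_sum _ _ _))// mulr_suml ler_sum// => i _.
rewrite (le_trans (ler_norm_sum _ _ _))// mulr_suml ler_sum// => j _.
rewrite mulrAC normrM mulrC ler_wpM2l//.
have sq_le l : `|v l 0| ^+ 2 <= sqnorm v.
  rewrite /sqnorm (bigD1 l)//= real_normK ?num_real// lerDl.
  by apply: sumr_ge0 => ? _; exact: sqr_ge0.
rewrite normrM; have := sq_le i; have := sq_le j.
have := sqr_ge0 (`|v i 0| - `|v j 0|); nra.
Qed.

Lemma bform_sub k (A : 'M[R]_k) x y (t : R) : A^T = A ->
  bform A (x - t *: y) (x - t *: y) =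
  bform A x x - 2 * t * bform A x y + t ^+ 2 * bform A y y.
Proof.
move=> sA.
have sym : bform A y x = bform A x y.
  rewrite /bform -[in LHS](trmxK (_ *m x)) mxE !trmx_mul trmxK sA.
  by rewrite mulmxA.
rewrite /bform in sym *.
have -> : (x - t *: y)^T = x^T - t *: y^T by apply/matrixP => i j; rewrite !mxE.
rewrite !mulmxBl !mulmxBr -!scalemxAl -!scalemxAr -?scalemxAl.
rewrite !mxE in sym *; rewrite sym; ring.
Qed.

Lemma posdefmx_unit k (A : 'M[R]_k) : posdefmx A -> A \in unitmx.
Proof.
move=> [sA pA]; rewrite -row_free_unit -kermx_eq0; apply: contraT => /negP kA.
have /rowV0Pn[u /sub_kermxP uA u0] : kermx A != 0 by apply/negP.
have := pA u^T; rewrite trmxK uA mul0mx mxE ltxx; apply.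
by apply: contra_neq u0 => /(congr1 trmx); rewrite trmxK trmx0.
Qed.

(* Cauchy-Schwarz for the form [A] applied to [v] and [invmx A *m v], whose
   product is [sqnorm v]. *)
Lemma posdefmx_coercive k (A : 'M[R]_k) : posdefmx A ->
  exists2 c, 0 < c & forall v, c * sqnorm v <= bform A v v.
Proof.
move=> pA; have uA := posdefmx_unit pA; case: pA => sA pA.
set C := 1 + \sum_i \sum_j `|invmx A i j|.
have C0 : 0 < C.
  by rewrite ltr_pwDl// sumr_ge0// => i _; apply: sumr_ge0.
exists C^-1; rewrite ?invr_gt0// => v.
have [->|v0] := eqVneq v 0.
  rewrite /bform /sqnorm mulmx0 mxE big1 ?mulr0// => i _.
  by rewrite mxE expr0n.
have d0 : 0 < bform A v v by exact: pA.
set w := invmx A *m v.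
have wA : w^T *m A = v^T.
  by rewrite /w trmx_mul trmx_inv sA -mulmxA mulVmx// mulmx1.
have wv : bform A w v = sqnorm v by rewrite /bform wA sqnormE.
have ww : bform A w w = bform (invmx A) v v by rewrite /bform wA /w mulmxA.
have wC : bform A w w <= C * sqnorm v.
  rewrite ww (le_trans (ler_norm _))// (le_trans (bform_le _ _))//.
  by rewrite ler_wpM2r ?sqnorm_ge0// lerDr.
have psd x : 0 <= bform A x x.
  have [->|/pA/ltW//] := eqVneq x 0.
  by rewrite /bform mulmx0 mxE.
(* The multiple of [v] is the minimiser of the quadratic in [t]. With [q = sqnorm v], it yields [q
   ^+ 2 <= bform A w w * bform A v v <= C * q * bform A v v], and [q] is cancelled. *)
have := psd (w - (sqnorm v / bform A v v) *: v).
rewrite bform_sub// wv; move: wC d0 (sqnorm_ge0 v).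
move: (bform A w w) (bform A v v) (sqnorm v) => a e q aq e0 q0.
rewrite (_ : a - _ + _ = a - q ^+ 2 / e); last by field; rewrite gt_eqF.
rewrite subr_ge0 ler_pdivrMr// => qa.
have [->|qn] := eqVneq q 0; first by rewrite mulr0 ltW.
rewrite mulrC ler_pdivrMr//; have qp : 0 < q by rewrite lt_def qn.
by rewrite -(ler_pM2l qp) -expr2 (le_trans qa)// mulrC (mulrC e) mulrA mulrAC ler_pM2r// mulrC.
Qed.

(** Coercivity excludes a kernel, so [u = invmx A *m J] solves [A u = J], and the form equals
    [J . u], which is at least [c * sqnorm u]. Expanding [0 <= sqnorm (J - c u)] then bounds
    [c * (J . u)] by [sqnorm J]. *)
Lemma quadratic_inverse_le k (A : 'M[R]_k) (c : R) (J : 'cV[R]_k) : 0 < c ->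
  (forall v, c * sqnorm v <= bform A v v) ->
  (J^T *m invmx A *m J) 0 0 <= c^-1 * sqnorm J.
Proof.
move=> c0 cA.
have uA : A \in unitmx.
  rewrite -row_free_unit -kermx_eq0; apply: contraT => /negP kA.
  have /rowV0Pn[u /sub_kermxP uA u0] : kermx A != 0 by apply/negP.
  have := cA u^T; rewrite /bform trmxK uA mul0mx mxE pmulr_rle0// => u2.
  case/negP: u0; apply/eqP/rowP => j; rewrite mxE; apply/eqP.
  rewrite -sqrf_eq0 eq_le sqr_ge0 andbT (le_trans _ u2)//.
  rewrite /sqnorm (bigD1 j)//= mxE lerDl.
  by apply: sumr_ge0 => ? _; exact: sqr_ge0.
set u := invmx A *m J.
have Ju : (J^T *m invmx A *m J) 0 0 = \sum_i J i 0 * u i 0.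
  by rewrite -mulmxA mxE; apply: eq_bigr => i _; rewrite mxE.
have uu : bform A u u = \sum_i J i 0 * u i 0.
  rewrite /bform -mulmxA /u mulKVmx// mxE; apply: eq_bigr => i _.
  by rewrite mxE mulrC.
rewrite Ju; have := cA u; rewrite uu.
have : 0 <= \sum_i (J i 0 - c * u i 0) ^+ 2.
  by apply: sumr_ge0 => i _; exact: sqr_ge0.
rewrite (_ : \sum_i _ = sqnorm J - 2 * c * (\sum_i J i 0 * u i 0) +
    c * (c * sqnorm u)).
  move: (\sum_i _) (sqnorm J) (sqnorm u) => a q p h1 h2.
  have : c * (c * p) <= c * a by rewrite ler_pM2l.
  by rewrite ler_pdivlMl//; lra.
rewrite /sqnorm !mulr_sumr -sumrB -big_split; apply: eq_bigr => i _ /=; ring.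
Qed.

Lemma bform_perturb k (A B : 'M[R]_k) (c : R) :
  (forall v, c * sqnorm v <= bform A v v) ->
  \sum_i \sum_j `|(B - A) i j| <= c / 2 ->
  forall v, c / 2 * sqnorm v <= bform B v v.
Proof.
move=> cA AB v; have := bform_le (B - A) v.
have -> : bform (B - A) v v = bform B v v - bform A v v.
  by rewrite /bform mulmxBr mulmxBl !mxE.
rewrite ler_norml => /andP[h _]; have := cA v.
have : (\sum_i \sum_j `|(B - A) i j|) * sqnorm v <= c / 2 * sqnorm v.
  by rewrite ler_wpM2r ?sqnorm_ge0.
move: h; lra.
Qed.

End QuadraticForms.

Section Deterministic.
Context {R : realType}.
Variables (z w x u : nat -> R).

(* Coordinate [i.+1] of the paper's V_s. *)
Definition moment_gap (i s : nat) : R :=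
  (deconv_poly z i.+1).[x s] - (deconv_poly w i.+1).[u s].

Lemma scoreE k s (i : 'I_k) j : score z w x u k s i j = moment_gap i s.
Proof. by rewrite mxE. Qed.

Lemma Sigma_hatE n k (i j : 'I_k) :
  Sigma_hat z w x u n k i j =
  n%:R^-1 * \sum_(s < n) (moment_gap i s * moment_gap j s).
Proof.
rewrite mxE summxE; congr (_ * _); apply: eq_bigr => s _.
by rewrite mxE big_ord1 !mxE.
Qed.

Lemma JstatE n k (i : 'I_k) j :
  Jstat z w x u n k i j = (Num.sqrt n%:R)^-1 * \sum_(s < n) moment_gap i s.
Proof.
rewrite mxE summxE; congr (_ * _); apply: eq_bigr => s _.
by rewrite scoreE.
Qed.

Lemma sqnorm_Jstat n k : sqnorm (Jstat z w x u n k) =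
  n%:R^-1 * \sum_(i < k) (\sum_(s < n) moment_gap i s) ^+ 2.
Proof.
rewrite mulr_sumr; apply: eq_bigr => i _.
by rewrite JstatE exprMn exprVn sqr_sqrtr.
Qed.

(* With a zero denominator both sides are 0: [invmx] fixes the zero matrix. *)
Lemma Tstat1E n : Tstat z w x u n 1 =
  ((Num.sqrt n%:R)^-1 * \sum_(s < n) moment_gap 0 s) ^+ 2 /
  (n%:R^-1 * \sum_(s < n) moment_gap 0 s ^+ 2).
Proof.
rewrite /Tstat; have -> : Sigma_hat z w x u n 1 =
    (n%:R^-1 * \sum_(s < n) moment_gap 0 s ^+ 2)%:M.
  apply/matrixP => i j; rewrite !ord1 Sigma_hatE mxE eqxx mulr1n.
  by congr (_ * _); apply: eq_bigr => s _; rewrite expr2.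
rewrite invmx_scalar mul_mx_scalar -scalemxAl !mxE big_ord1 mxE !JstatE /=.
by rewrite expr2 mulrC.
Qed.

Lemma Tstat1_ge0 n : 0 <= Tstat z w x u n 1.
Proof.
rewrite Tstat1E divr_ge0 ?sqr_ge0// mulr_ge0 ?invr_ge0//.
by apply: sumr_ge0 => s _; exact: sqr_ge0.
Qed.

Lemma Sstat_eq1 K n : (0 < K)%N -> (0 < n)%N ->
  (forall k, (2 <= k <= K)%N -> Tstat z w x u n k < ln n%:R) ->
  Sstat z w x u K n = 1%N.
Proof.
move=> K0 n0 small; have := @least_argmaxP R
  (fun k => Tstat z w x u n k - k%:R * ln n%:R) K K0.
rewrite -/(Sstat z w x u K n) => -[/andP[S1 SK] Smax _].
apply/eqP; rewrite eqn_leq S1 andbT leqNgt; apply/negP => S2.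
have := Smax 1%N; rewrite K0 => /(_ isT).
have := small (Sstat z w x u K n); rewrite S2 SK => /(_ isT).
have l0 : 0 <= ln (n%:R : R) by rewrite ln_ge0// ler1n.
have r2 : (2 : R) <= (Sstat z w x u K n)%:R by rewrite ler_nat.
have := Tstat1_ge0 n; rewrite mul1r.
have : 2 * ln n%:R <= (Sstat z w x u K n)%:R * ln n%:R :> R by rewrite ler_wpM2r.
lra.
Qed.

End Deterministic.

(** * Measurability of the selected statistic *)

Section Measurability.
Context {d} {Omega : measurableType d} {R : realType}.

Lemma measurable_invr : measurable_fun setT (fun x : R => x^-1).
Proof.
have -> : (fun x : R => x^-1) = fun x => if x == 0 then 0 else x^-1.
  by apply/funext => x; case: eqP => // ->; rewrite invr0.
apply: measurable_fun_if => //; first exact: measurable_fun_eqr.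
have -> : [set: R] `&` (fun x => x == 0) @^-1` [set false] = ~` [set 0].
  rewrite setTI; apply/seteqP; split => x /=; first by move=> /eqP.
  by move=> /eqP/negbTE.
apply: open_continuous_measurable_fun.
  by apply: closed_openC; exact: closed_eq.
by move=> x; rewrite inE /= => /eqP; exact: inv_continuous.
Qed.

Lemma measurable_prod_fun (I : Type) (s : seq I) (F : I -> Omega -> R) :
  (forall i, measurable_fun setT (F i)) ->
  measurable_fun setT (fun o => \prod_(i <- s) F i o).
Proof.
move=> mF; elim: s => [|i s IH].
  by under eq_fun do rewrite big_nil; exact: measurable_cst.
by under eq_fun do rewrite big_cons; exact: measurable_funM.
Qed.

Lemma measurable_det k (A : Omega -> 'M[R]_k) :
  (forall i j, measurable_fun setT (fun o => A o i j)) ->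
  measurable_fun setT (fun o => \det (A o)).
Proof.
move=> mA; apply: measurable_sum => s; apply: measurable_funM => //.
exact: measurable_prod_fun.
Qed.

Lemma measurable_invmx k (A : Omega -> 'M[R]_k) i j :
  (forall i j, measurable_fun setT (fun o => A o i j)) ->
  measurable_fun setT (fun o => invmx (A o) i j).
Proof.
move=> mA; have mdet := measurable_det mA.
(* On singular matrices [invmx] returns its argument, whence the first branch; elsewhere Cramer's
   formula applies. *)
have -> : (fun o => invmx (A o) i j) = fun o =>
    if \det (A o) == 0 then A o i j else (\det (A o))^-1 * (\adj (A o)) i j.
  apply/funext => o; rewrite /invmx unitmxE unitfE.
  by case: eqP => _; rewrite ?mxE.
apply: measurable_fun_if => //.
- exact: measurable_fun_eqr.
- apply: measurable_funTS; apply: mA.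
- apply: measurable_funTS; apply: measurable_funM.
    by apply: measurableT_comp => //; exact: measurable_invr.
  under eq_fun do rewrite mxE; apply: measurable_funM => //.
  apply: measurable_det => a b.
  by under eq_fun do rewrite !mxE; exact: mA.
Qed.

Variables (z w : nat -> R) (X U : nat -> Omega -> R).
Hypothesis mX : forall s, measurable_fun setT (X s).
Hypothesis mU : forall s, measurable_fun setT (U s).

Lemma measurable_horner (p : {poly R}) (Y : Omega -> R) :
  measurable_fun setT Y -> measurable_fun setT (fun o => p.[Y o]).
Proof.
move=> mY; elim/poly_ind: p => [|p c IH].
  by under eq_fun do rewrite horner0; exact: measurable_cst.
under eq_fun do rewrite hornerMXaddC.
by apply: measurable_funD => //; exact: measurable_funM.
Qed.

Lemma measurable_moment_gap i s : measurable_fun setT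
  (fun o => moment_gap z w (fun s => X s o) (fun s => U s o) i s).
Proof. by apply: measurable_funB; exact: measurable_horner. Qed.

Let T n k o := Tstat z w (fun s => X s o) (fun s => U s o) n k.

Lemma measurable_Tstat n k : measurable_fun setT (T n k).
Proof.
have -> : T n k = fun o => bform
    (invmx (Sigma_hat z w (fun s => X s o) (fun s => U s o) n k))
    (Jstat z w (fun s => X s o) (fun s => U s o) n k)
    (Jstat z w (fun s => X s o) (fun s => U s o) n k) by [].
under eq_fun do rewrite bformE.
have mJ (i : 'I_k) : measurable_fun setT
    (fun o => Jstat z w (fun s => X s o) (fun s => U s o) n k i 0).
  under eq_fun do rewrite JstatE; apply: measurable_funM => //.
  by apply: measurable_sum => s; exact: measurable_moment_gap.
apply: measurable_sum => i; apply: measurable_sum => j.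
apply: measurable_funM => //; apply: measurable_funM => //.
apply: measurable_invmx => a b.
under eq_fun do rewrite Sigma_hatE; apply: measurable_funM => //.
apply: measurable_sum => s; apply: measurable_funM; exact: measurable_moment_gap.
Qed.

(** The index is random but has finitely many candidates, each selected by a measurable boolean
    [M k]; induction on the candidate list turns the choice into nested conditionals. The default
    index 0 of [head] gives a measurable value as well. *)
Lemma measurable_Tstat_Sstat K n : measurable_fun setT
  (fun o => T n (Sstat z w (fun s => X s o) (fun s => U s o) K n) o).
Proof.
rewrite /Sstat /least_argmax -/(T n).
pose L k o := T n k o - k%:R * ln n%:R.
pose M k o := all (fun j => L j o <= L k o) (iota 1 K).
have mL k : measurable_fun setT (L k) by apply: measurable_funB => //; exact: measurable_Tstat.
have mM k : measurable_fun setT (M k).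
  rewrite /M; elim: (iota 1 K) => [|j s IH] /=; first exact: measurable_cst.
  by apply: measurable_and => //; exact: measurable_fun_ler.
suff H s : measurable_fun setT (fun o => T n (head 0%N [seq k <- s | M k o]) o).
  exact: H.
elim: s => [|k s IH] /=; first exact: measurable_Tstat.
have -> : (fun o => T n (head 0%N (if M k o then k :: [seq k <- s | M k o]
      else [seq k <- s | M k o])) o) =
    fun o => if M k o then T n k o else T n (head 0%N [seq k <- s | M k o]) o.
  by apply/funext => o; case: (M k o).
apply: measurable_fun_ifT => //; exact: measurable_Tstat.
Qed.

End Measurability.

(** * Moments and the law of large numbers *)

Section AbsMoments.
Context {d} {Omega : measurableType d} {R : realType} (P : probability Omega R).
Implicit Types X Y : Omega -> R.

(** Absolute powers make the notion visibly stable under sums and products, hence under polynomials,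
    and include the third absolute moment of the replacement argument. *)
Definition abs_moments X := measurable_fun setT X /\
  forall k : nat, P.-integrable setT (EFin \o (fun o => `|X o| ^+ k)).

Lemma has_all_moments_abs X : has_all_moments P X -> abs_moments X.
Proof.
move=> hX; split; first by apply: integrable_EFin_measurable; exact: (hX 1%N).
move=> k; have := integrable_EFin_norm (hX k).
by apply: eq_integrable => // o _; rewrite /= normrX.
Qed.

Lemma abs_moments_cst (c : R) : abs_moments (fun=> c).
Proof. by split=> [|k]; [exact: measurable_cst|exact: integrable_EFin_cst]. Qed.

Lemma abs_momentsD X Y : abs_moments X -> abs_moments Y ->
  abs_moments (fun o => X o + Y o).
Proof.
move=> [mX iX] [mY iY]; have mXY : measurable_fun setT (fun o => X o + Y o).
  exact: measurable_funD.
split => // k.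
apply: (integrable_EFin_le _ _ (integrable_EFinZ (2 ^+ k) (integrable_EFinD (iX k) (iY k)))).
  by apply: measurable_funX; apply: measurableT_comp => //; exact: normr_measurable.
move=> o; rewrite ger0_norm ?exprn_ge0//.
have bound (a b : R) : `|a| <= `|b| -> `|a + b| ^+ k <= 2 ^+ k * (`|a| ^+ k + `|b| ^+ k).
  move=> ab; rewrite (@le_trans _ _ ((2 * `|b|) ^+ k))//.
    rewrite lerXn2r ?nnegrE ?mulr_ge0// (le_trans (ler_normD _ _))//; lra.
  by rewrite exprMn ler_wpM2l ?exprn_ge0// lerDr exprn_ge0.
have [XY|/ltW YX] := lerP `|X o| `|Y o|; first exact: bound.
by rewrite addrC (addrC (_ ^+ k)); exact: bound.
Qed.

Lemma abs_momentsM X Y : abs_moments X -> abs_moments Y ->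
  abs_moments (fun o => X o * Y o).
Proof.
move=> [mX iX] [mY iY]; have mXY : measurable_fun setT (fun o => X o * Y o).
  exact: measurable_funM.
split => // k; apply: (integrable_EFin_le _ _ (integrable_EFinD (iX (k * 2)%N) (iY (k * 2)%N))).
  by apply: measurable_funX; apply: measurableT_comp => //; exact: normr_measurable.
move=> o; rewrite ger0_norm ?exprn_ge0// normrM exprMn !exprM.
have : 0 <= `|X o| ^+ k by rewrite exprn_ge0.
have : 0 <= `|Y o| ^+ k by rewrite exprn_ge0.
move: (`|X o| ^+ k) (`|Y o| ^+ k) => a b; have := sqr_ge0 (a - b); nra.
Qed.

Lemma abs_momentsX X k : abs_moments X -> abs_moments (fun o => X o ^+ k).
Proof.
move=> aX; elim: k => [|k IH]; first exact: abs_moments_cst.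
by under eq_fun do rewrite exprS; exact: abs_momentsM.
Qed.

Lemma abs_momentsB X Y : abs_moments X -> abs_moments Y ->
  abs_moments (fun o => X o - Y o).
Proof.
move=> aX aY; under eq_fun do rewrite -mulN1r.
by apply: abs_momentsD => //; apply: abs_momentsM => //; exact: abs_moments_cst.
Qed.

Lemma abs_moments_sum (I : Type) (s : seq I) (F : I -> Omega -> R) :
  (forall i, abs_moments (F i)) -> abs_moments (fun o => \sum_(i <- s) F i o).
Proof.
move=> aF; elim: s => [|i s IH].
  by under eq_fun do rewrite big_nil; exact: abs_moments_cst.
by under eq_fun do rewrite big_cons; exact: abs_momentsD.
Qed.

Lemma abs_moments_horner (p : {poly R}) X : abs_moments X ->
  abs_moments (fun o => p.[X o]).
Proof.
move=> aX; elim/poly_ind: p => [|p c IH].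
  by under eq_fun do rewrite horner0; exact: abs_moments_cst.
under eq_fun do rewrite hornerMXaddC.
by apply: abs_momentsD; [exact: abs_momentsM|exact: abs_moments_cst].
Qed.

Lemma abs_moments_integrable X : abs_moments X -> P.-integrable setT (EFin \o X).
Proof. by move=> [mX iX]; apply: integrable_EFin_le mX _ (iX 1%N) => o; rewrite expr1. Qed.

Lemma abs_moments_same_law X X' : measurable_fun setT X' -> same_law P X X' ->
  abs_moments X -> abs_moments X'.
Proof.
move=> mX' XX' [mX iX]; split => // k.
have mk : measurable_fun setT (fun x : R => `|x| ^+ k).
  by apply: measurable_funX; exact: normr_measurable.
apply: (same_law_integrable _ _ (same_law_comp mk XX') (iX k)).
- exact: measurableT_comp.
- exact: measurableT_comp.
Qed.

Lemma momentE X i : moment P X i = \int[P]_o (X o ^+ i).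
Proof. by rewrite /moment unlock. Qed.

Lemma moment0 X : moment P X 0 = 1.
Proof. by rewrite momentE; under eq_Rintegral do rewrite expr0; exact: Rintegral_prob_cst. Qed.

Lemma momentD_independent X Y i : abs_moments X -> abs_moments Y ->
  independent_pair P X Y ->
  \int[P]_o ((X o + Y o) ^+ i) =
  \sum_(j < i.+1) 'C(i, j)%:R * moment P Y (i - j) * moment P X j.
Proof.
move=> aX aY XY.
have iXk k := abs_moments_integrable (abs_momentsX k aX).
have iYk k := abs_moments_integrable (abs_momentsX k aY).
have mk k : measurable_fun setT (fun x : R => x ^+ k) by exact: exprn_measurable.
have iXY k l := independent_mul (independent_pair_comp (mk k) (mk l) XY) (iXk k) (iYk l).
under eq_Rintegral => o _.
  rewrite addrC exprDn; under eq_bigr do rewrite -mulr_natl.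
  over.
rewrite Rintegral_sum; last first.
  move=> j; apply: integrable_EFinZ; have [+ _] := iXY j (i - j)%N.
  by apply: eq_integrable => // o _; rewrite /= mulrC.
apply: eq_bigr => j _; rewrite RintegralZl//; last first.
  by have [+ _] := iXY j (i - j)%N; apply: eq_integrable => // o _; rewrite /= mulrC.
rewrite -mulrA; congr (_ * _); rewrite !momentE mulrC.
have [_ <-] := iXY j (i - j)%N; apply: eq_Rintegral => o _.
by rewrite /= mulrC.
Qed.

(** Here [X] is the signal and [Y] the noise. By strong induction the terms subtracted in the
    recurrence have as expectations the lower terms of the binomial expansion of the i-th moment of
    [X + Y]; only the top one survives. *)
Lemma expectation_deconv_poly X Y i : abs_moments X -> abs_moments Y ->
  independent_pair P X Y ->
  \int[P]_o (deconv_poly (moment P Y) i).[X o + Y o] = moment P X i.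
Proof.
move=> aX aY XY; have aS := abs_momentsD aX aY.
have iP k := abs_moments_integrable (abs_moments_horner (deconv_poly (moment P Y) k) aS).
have iS k := abs_moments_integrable (abs_momentsX k aS).
elim/ltn_ind: i => i IH.
under eq_Rintegral => o _.
  rewrite deconv_polyE hornerD hornerN horner_sum hornerXn.
  under eq_bigr do rewrite hornerZ.
  over.
rewrite RintegralB//; last first.
  by apply: integrable_EFin_sum => j; exact: integrable_EFinZ.
rewrite Rintegral_sum; last by move=> j; exact: integrable_EFinZ.
rewrite momentD_independent// big_ord_recr /= subnn moment0 binn !mul1r.
rewrite [X in _ - X](_ : _ = \sum_(j < i) 'C(i, j)%:R * moment P Y (i - j) * moment P X j).
  by rewrite addrAC subrr add0r.
by apply: eq_bigr => j _; rewrite RintegralZl// IH.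
Qed.

End AbsMoments.

(** * Events of vanishing probability *)

Section LargeNumbers.
Context {d} {Omega : measurableType d} {R : realType} (P : probability Omega R).

Definition negligible_seq (B : nat -> set Omega) := (forall n, measurable (B n)) /\
  forall e : R, 0 < e -> \forall n \near \oo, (P (B n) <= e%:E)%E.

Lemma negligible_seqU B C : negligible_seq B -> negligible_seq C ->
  negligible_seq (fun n => B n `|` C n).
Proof.
move=> [mB vB] [mC vC]; split=> [n|e e0]; first exact: measurableU.
have e2 : 0 < e / 2 by rewrite divr_gt0.
near=> n; rewrite (le_trans (measureU2 P (mB n) (mC n)))//.
rewrite (_ : e = e / 2 + e / 2); last by field.
by rewrite EFinD leeD//; near: n; [exact: vB|exact: vC].
Unshelve. all: by end_near. Qed.

Lemma negligible_seq_bigU (I : Type) (s : seq I) (B : I -> nat -> set Omega) :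
  (forall i, negligible_seq (B i)) ->
  negligible_seq (fun n => \big[setU/set0]_(i <- s) B i n).
Proof.
move=> vB; elim: s => [|i s IH].
  under eq_fun do rewrite big_nil; split => // e e0.
  by near=> n; rewrite measure0 lee_fin ltW.
by under eq_fun do rewrite big_cons; exact: negligible_seqU.
Unshelve. all: by end_near. Qed.

Lemma markov_real (Y : Omega -> R) (a : R) : 0 < a -> (forall o, 0 <= Y o) ->
  P.-integrable setT (EFin \o Y) ->
  measurable [set o | a <= Y o] /\
  (P [set o | (a <= Y o)%R] <= ((\int[P]_o Y o) / a)%:E)%E.
Proof.
move=> a0 Y0 iY; have mY := integrable_EFin_measurable iY.
pose Y' : {RV P >-> R} := mfun_Sub (mem_set mY).
have mA : measurable [set o | a <= Y o].
  have -> : [set o | a <= Y o] = Y @^-1` `[a, +oo[.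
    by apply/seteqP; split => o /=; rewrite in_itv/= andbT.
  exact: measurable_preimage.
split => //.
have := @markov _ _ _ P Y' id a a0 (@measurable_id _ _ _) (fun _ h => h)
  (fun _ _ _ _ h => h).
have -> : [set o | (a%:E <= `|(Y' o)%:E|)%E] = [set o | a <= Y o].
  by apply/seteqP; split => o /=; rewrite lee_fin ger0_norm.
have -> : ('E_P[(id \o (fun x : R => `|x|) \o Y')%R] = (\int[P]_o Y o)%:E)%E.
  rewrite unlock /Rintegral fineK; last exact: integrable_fin_num.
  by apply: eq_integral => o _; rewrite /= ger0_norm.
by rewrite mulrC EFinM lee_pdivlMl.
Qed.

End LargeNumbers.

Section Negligible.
Context {d} {Omega : measurableType d} {R : realType} (P : probability Omega R).

(** The threshold may move with n: it is a fixed [e ^+ 2] in the weak law, and a multiple of [ln n]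
    in the tightness bound, where the expectation does not decrease. *)
Lemma negligible_seq_markov (Y : nat -> Omega -> R) (a : nat -> R) (v : nat -> R) :
  (forall n o, 0 <= Y n o) -> (forall n, P.-integrable setT (EFin \o Y n)) ->
  (forall n, \int[P]_o Y n o <= v n) ->
  (forall e : R, 0 < e -> \forall n \near \oo, 0 < a n /\ v n <= e * a n) ->
  negligible_seq P (fun n => [set o | a n <= Y n o]).
Proof.
move=> Y0 iY vY va; split=> [n|e e0].
  have mY := integrable_EFin_measurable (iY n).
  rewrite (_ : [set o | _] = Y n @^-1` `[a n, +oo[); first exact: measurable_preimage.
  by apply/seteqP; split => o /=; rewrite in_itv/= andbT.
near=> n; have [an0 vn] : 0 < a n /\ v n <= e * a n by near: n; exact: va.
have [_ /le_trans] := markov_real an0 (Y0 n) (iY n); apply.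
by rewrite lee_fin ler_pdivrMr// (le_trans (vY n)).
Unshelve. all: by end_near. Qed.

End Negligible.

(** * Averages over an i.i.d. sample of pairs *)

Section Sample.
Context {d} {Omega : measurableType d} {R : realType} (P : probability Omega R).
Variables (X U : {RV P >-> R}) (Xs Us : nat -> {RV P >-> R}).
Hypothesis ind_sample : mutually_independent P (fun s o => (Xs s o, Us s o)).
Hypothesis law_sample : forall s,
  same_law P (fun o => (Xs s o, Us s o)) (fun o => (X o, U o)).

Local Notation pop h := (fun o => h (X o, U o)).
Local Notation sample h := (fun s o => h (Xs s o, Us s o)).

Lemma measurable_sample (h : R * R -> R) s : measurable_fun setT h ->
  measurable_fun setT (sample h s).
Proof. by move=> mh; apply: measurableT_comp => //; exact: measurable_fun_pair. Qed.

Lemma sample_independent (h : R * R -> R) : measurable_fun setT h ->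
  mutually_independent P (sample h).
Proof.
move=> mh I A uI mA; apply: (ind_sample (A := fun i => h @^-1` A i)) => // i.
exact: measurable_preimage.
Qed.

Lemma sample_same_law (h : R * R -> R) s : measurable_fun setT h ->
  same_law P (pop h) (sample h s).
Proof.
by move=> mh A mA; apply/esym; apply: (same_law_comp mh (law_sample s)).
Qed.

Lemma sample_abs_moments (h : R * R -> R) s : measurable_fun setT h ->
  abs_moments P (pop h) -> abs_moments P (sample h s).
Proof.
move=> mh; apply: abs_moments_same_law; first exact: measurable_sample.
exact: sample_same_law.
Qed.

Lemma sample_expectation (h : R * R -> R) s : measurable_fun setT h ->
  abs_moments P (pop h) -> \int[P]_o sample h s o = \int[P]_o (pop h) o.
Proof.
move=> mh ah; apply/esym/same_law_Rintegral.
- exact: measurable_sample.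
- exact: sample_same_law.
- exact: abs_moments_integrable.
Qed.

Lemma sample_second_moment (h : R * R -> R) n : measurable_fun setT h ->
  abs_moments P (pop h) -> \int[P]_o (pop h) o = 0 ->
  P.-integrable setT (EFin \o (fun o => (\sum_(s < n) sample h s o) ^+ 2)) /\
  \int[P]_o ((\sum_(s < n) sample h s o) ^+ 2) =
    n%:R * \int[P]_o ((pop h) o ^+ 2).
Proof.
move=> mh ah h0.
have as_ s := sample_abs_moments s mh ah.
apply: (@second_moment_partial_sum _ _ _ P (sample h)) => [s||s|s|s|s].
- exact: measurable_sample.
- exact: sample_independent.
- exact/abs_moments_integrable/abs_momentsX.
- exact: abs_moments_integrable.
- by rewrite sample_expectation.
- rewrite (@sample_expectation (fun p => h p ^+ 2))//; first exact: measurable_funX.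
  exact: abs_momentsX.
Qed.

(** Chebyshev's inequality: the centred empirical mean has second moment [v / n]. *)
Lemma weak_law (h : R * R -> R) (e : R) : measurable_fun setT h ->
  abs_moments P (pop h) -> 0 < e ->
  negligible_seq P (fun n => [set o |
    e <= `|n%:R^-1 * \sum_(s < n) sample h s o - \int[P]_o (pop h) o|]).
Proof.
move=> mh ah e0; set a := \int[P]_o (pop h) o.
pose g p := h p - a; have mg : measurable_fun setT g by exact: measurable_funB.
have ag : abs_moments P (pop g).
  by apply: abs_momentsB => //; exact: abs_moments_cst.
have g0 : \int[P]_o (pop g) o = 0.
  rewrite RintegralB//; [|exact: abs_moments_integrable|exact: integrable_EFin_cst].
  by rewrite Rintegral_prob_cst subrr.
set v := \int[P]_o ((pop g) o ^+ 2).
have v0 : 0 <= v by apply: Rintegral_ge0 => o _; exact: sqr_ge0.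
pose Y n o := n%:R^-1 ^+ 2 * (\sum_(s < n) sample g s o) ^+ 2.
have iY n : P.-integrable setT (EFin \o Y n).
  by apply: integrable_EFinZ; have [] := sample_second_moment n mg ag g0.
have eY n : \int[P]_o Y n o = n%:R^-1 ^+ 2 * (n%:R * v).
  have [i2 e2] := sample_second_moment n mg ag g0.
  by rewrite RintegralZl// e2.
have Ysq n o : (0 < n)%N ->
    Y n o = (n%:R^-1 * \sum_(s < n) sample h s o - a) ^+ 2.
  move=> n0; rewrite /Y -exprMn /g sumrB sumr_const card_ord mulrBr.
  by rewrite -(mulr_natl a) mulKf// pnatr_eq0 -lt0n.
have B : negligible_seq P (fun n => [set o | e ^+ 2 <= Y n o]).
  apply: (@negligible_seq_markov _ _ _ P Y (fun=> e ^+ 2)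
    (fun n => n%:R^-1 ^+ 2 * (n%:R * v))) => //.
  - by move=> n o; rewrite mulr_ge0 ?sqr_ge0.
  - by move=> n; rewrite eY.
  move=> b b0; near=> n; split; first by rewrite exprn_gt0.
  have n0 : (0 < n)%N by near: n; exact: nbhs_infty_gt.
  have nR : 0 < n%:R :> R by rewrite ltr0n.
  rewrite (_ : _ * (_ * v) = v / n%:R); last by field; rewrite gt_eqF.
  rewrite ler_pdivrMr// mulrC -ler_pdivrMr ?mulr_gt0 ?exprn_gt0//.
  by near: n; exact: nbhs_infty_ger.
case: B => mB vB.
have sq t : (e <= `|t|) = (e ^+ 2 <= t ^+ 2).
  by rewrite -[in RHS](real_normK (num_real t)) ler_sqr// nnegrE ltW.
have eqB n : (0 < n)%N -> [set o | e <= `|n%:R^-1 * \sum_(s < n) sample h s o - a|] =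
    [set o | e ^+ 2 <= Y n o].
  by move=> n0; apply/seteqP; split => o /=; rewrite Ysq// sq.
split=> [n|b b0].
  (* For [n = 0] the empirical mean is 0 by convention, and the event is everything or nothing. *)
  case: n => [|n]; last by rewrite eqB.
  under eq_fun do rewrite big_ord0 mulr0 sub0r normrN.
  have [ea|ae] := boolP (e <= `|a|).
    by rewrite (_ : [set o | _] = setT)//; apply/seteqP.
  by rewrite (_ : [set o | _] = set0)//; apply/seteqP; split => // o /=; rewrite (negbTE ae).
near=> n; rewrite eqB//; last by near: n; exact: nbhs_infty_gt.
by near: n; exact: vB.
Unshelve. all: by end_near. Qed.

Lemma near_ln_ge (A : R) : \forall n \near \oo, A <= ln (n%:R : R).
Proof.
near=> n; have h : expR A <= n%:R by near: n; exact: nbhs_infty_ger.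
rewrite -(expRK A) ler_ln// posrE ?expR_gt0// (lt_le_trans _ h)//.
exact: expR_gt0.
Unshelve. all: by end_near. Qed.

Lemma tight_sum (h : R * R -> R) (c : R) : measurable_fun setT h ->
  abs_moments P (pop h) -> \int[P]_o (pop h) o = 0 -> 0 < c ->
  negligible_seq P (fun n => [set o |
    c * ln n%:R <= n%:R^-1 * (\sum_(s < n) sample h s o) ^+ 2]).
Proof.
move=> mh ah h0 c0.
set v := \int[P]_o ((pop h) o ^+ 2).
have v0 : 0 <= v by apply: Rintegral_ge0 => o _; exact: sqr_ge0.
apply: (@negligible_seq_markov _ _ _ P _ _ (fun=> v)).
- by move=> n o; rewrite mulr_ge0 ?invr_ge0 ?sqr_ge0.
- by move=> n; apply: integrable_EFinZ; have [] := sample_second_moment n mh ah h0.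
- move=> n; have [i2 e2] := sample_second_moment n mh ah h0.
  rewrite RintegralZl// e2 -/v mulrA; case: n {i2 e2} => [|n].
    by rewrite invr0 !mul0r.
  by rewrite mulVf ?mul1r// pnatr_eq0.
move=> e e0; near=> n.
have l1 : 1 <= ln (n%:R : R) by near: n; exact: near_ln_ge.
have lv : v / (e * c) <= ln (n%:R : R) by near: n; exact: near_ln_ge.
split; first by rewrite mulr_gt0//; lra.
by rewrite mulrA -ler_pdivrMl ?mulr_gt0// mulrC.
Unshelve. all: by end_near. Qed.

Variables (z w : nat -> R).

(** The gap as a function of one observed pair, so that independence and equality of laws transfer
    from the pairs to the summands by composition. *)
Definition gap_fun (i : nat) (p : R * R) : R :=
  (deconv_poly z i.+1).[p.1] - (deconv_poly w i.+1).[p.2].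

Lemma measurable_gap_fun i : measurable_fun setT (gap_fun i).
Proof. by apply: measurable_funB; apply: measurable_horner. Qed.

Lemma gap_funE i s o :
  moment_gap z w (fun s => Xs s o) (fun s => Us s o) i s = sample (gap_fun i) s o.
Proof. by []. Qed.

Hypothesis agap : forall i, abs_moments P (pop (gap_fun i)).
Hypothesis gap0 : forall i, \int[P]_o (pop (gap_fun i)) o = 0.

Definition Sigma_pop k : 'M[R]_k :=
  \matrix_(i, j) \int[P]_o ((pop (gap_fun i)) o * (pop (gap_fun j)) o).

Let Shat n k o := Sigma_hat z w (fun s => Xs s o) (fun s => Us s o) n k.

Definition gap_comb k (v : 'cV[R]_k) (p : R * R) : R := \sum_(i < k) v i 0 * gap_fun i p.

Lemma measurable_gap_comb k (v : 'cV[R]_k) : measurable_fun setT (gap_comb v).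
Proof. by apply: measurable_sum => i; apply: measurable_funM => //; exact: measurable_gap_fun. Qed.

Lemma abs_moments_gap_comb k (v : 'cV[R]_k) : abs_moments P (pop (gap_comb v)).
Proof.
apply: abs_moments_sum => i; apply: abs_momentsM => //; exact: abs_moments_cst.
Qed.

Lemma gap_comb_sq k (v : 'cV[R]_k) p :
  gap_comb v p ^+ 2 = \sum_i \sum_j v i 0 * v j 0 * (gap_fun i p * gap_fun j p).
Proof.
rewrite expr2 /gap_comb mulr_suml; apply: eq_bigr => i _.
by rewrite mulr_sumr; apply: eq_bigr => j _; ring.
Qed.

Lemma bform_Sigma_pop k (v : 'cV[R]_k) :
  bform (Sigma_pop k) v v = \int[P]_o ((pop (gap_comb v)) o ^+ 2).
Proof.
rewrite bformE; under [RHS]eq_Rintegral do rewrite gap_comb_sq.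
have iij i j := abs_moments_integrable (abs_momentsM (agap i) (agap j)).
rewrite Rintegral_sum; last first.
  by move=> i; apply: integrable_EFin_sum => j; exact: integrable_EFinZ.
apply: eq_bigr => i _; rewrite Rintegral_sum; last by move=> j; exact: integrable_EFinZ.
apply: eq_bigr => j _; rewrite RintegralZl//.
by rewrite mxE mulrAC.
Qed.

Lemma bform_Sigma_hat n k o (v : 'cV[R]_k) :
  bform (Shat n k o) v v = n%:R^-1 * \sum_(s < n) sample (gap_comb v) s o ^+ 2.
Proof.
rewrite bformE mulr_sumr; under [RHS]eq_bigr do rewrite gap_comb_sq mulr_sumr.
rewrite [RHS]exchange_big /=; apply: eq_bigr => i _.
under [RHS]eq_bigr do rewrite mulr_sumr.
rewrite [RHS]exchange_big /=; apply: eq_bigr => j _.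
rewrite Sigma_hatE mulrAC mulrCA !mulr_sumr; apply: eq_bigr => s _.
by rewrite /= !gap_funE; ring.
Qed.

Lemma Sigma_pop_posdef k : 
  {ae P, forall o, \forall n \near \oo, posdefmx (Shat n k o)} ->
  posdefmx (Sigma_pop k).
Proof.
move=> aeS; split.
  by apply/matrixP => i j; rewrite !mxE; apply: eq_Rintegral => o _; rewrite mulrC.
move=> v v0; rewrite -[X in _ < X]/(bform _ _ _) bform_Sigma_pop.
rewrite lt_def Rintegral_ge0 ?andbT; last by move=> o _; exact: sqr_ge0.
apply/negP => /eqP E0.
have mg := measurable_gap_comb v; have ag := abs_moments_gap_comb v.
have mg2 : measurable_fun setT (fun p => gap_comb v p ^+ 2) by exact: measurable_funX.
(* A null second moment in the population is one for each observation; countably many null sets give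
   one null set valid for the whole sample. *)
have ae0 : {ae P, forall o, forall s, sample (gap_comb v) s o = 0}.
  apply: ae_foralln => s.
  have as_ := sample_abs_moments s mg ag.
  have i2 := abs_moments_integrable (abs_momentsX 2 as_).
  have e2 : \int[P]_o (sample (gap_comb v) s o ^+ 2) = 0.
    by rewrite (@sample_expectation (fun p => gap_comb v p ^+ 2))//; exact: abs_momentsX.
  have e0 : (\int[P]_o `|(sample (gap_comb v) s o ^+ 2)%:E| = 0)%E.
    under eq_integral do rewrite abse_EFin ger0_norm ?sqr_ge0//.
    by rewrite -[LHS]fineK ?[fine _]e2//; exact: integrable_fin_num.
  have mi := measurable_int P i2.
  move/(ae_eq_integral_abs P measurableT mi): e0; apply: filterS => o /(_ I) [].
  by move=> /eqP; rewrite sqrf_eq0 => /eqP.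
(* Two properties of full probability meet at some outcome, and there a single n suffices for the
   contradiction. *)
have [om [So zo]] : exists o, (\forall n \near \oo, posdefmx (Shat n k o)) /\
    (forall s, sample (gap_comb v) s o = 0).
  have [N [mN PN0 sN]] := filterI aeS ae0.
  apply: contrapT => /forallNP no; have : P setT = 0%E.
    apply/eqP; rewrite eq_le measure_ge0 andbT -PN0 le_measure ?inE//.
    by move=> o _; apply: sN; exact: no.
  by rewrite probability_setT => /eqP; rewrite onee_eq0.
case: So => n _ /(_ n (leqnn n)) [_ pd]; have := pd v v0.
rewrite -[X in _ < X]/(bform _ _ _) bform_Sigma_hat big1 ?mulr0 ?ltxx//.
by move=> s _; rewrite zo expr0n.
Qed.

End Sample.

(** * Probabilities compared with integrals of test functions *)

Section ProbabilityBounds.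
Context {d} {Omega : measurableType d} {R : realType} (P : probability Omega R).

Lemma probability_le_Rintegral (C : set Omega) (h : Omega -> R) : measurable C ->
  P.-integrable setT (EFin \o h) -> (forall o, 0 <= h o) ->
  (forall o, C o -> 1 <= h o) -> fine (P C) <= \int[P]_o h o.
Proof.
move=> mC ih h0 Ch.
have -> : fine (P C) = \int[P]_o (\1_C o).
  by rewrite /Rintegral integral_indic// setIT.
apply: le_Rintegral => //.
  by apply: (@integrable_EFin_bounded _ _ _ P 1) => // o;
    rewrite ger0_norm// indicE; case: (_ \in _).
move=> o _; rewrite indicE; case: (boolP (o \in C)) => [/set_mem/Ch//|_].
exact: h0.
Qed.

Lemma Rintegral_le_probability (C : set Omega) (h : Omega -> R) : measurable C ->
  P.-integrable setT (EFin \o h) -> (forall o, h o <= 1) ->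
  (forall o, ~ C o -> h o <= 0) -> \int[P]_o h o <= fine (P C).
Proof.
move=> mC ih h1 Ch.
have -> : fine (P C) = \int[P]_o (\1_C o).
  by rewrite /Rintegral integral_indic// setIT.
apply: le_Rintegral => //.
  by apply: (@integrable_EFin_bounded _ _ _ P 1) => // o;
    rewrite ger0_norm// indicE; case: (_ \in _).
move=> o _; rewrite indicE; case: (boolP (o \in C)) => [_|/negP oC].
  exact: h1.
by apply: Ch => Co; apply: oC; exact/mem_set.
Qed.

Lemma fine_probabilityU (A B : set Omega) : measurable A -> measurable B ->
  fine (P (A `|` B)) <= fine (P A) + fine (P B).
Proof.
move=> mA mB; rewrite -fineD ?fin_num_measure// fine_le//.
- by rewrite fin_num_measure//; exact: measurableU.
- by rewrite fin_numD !fin_num_measure.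
- exact: measureU2.
Qed.

Lemma fine_probabilityS (A B : set Omega) : measurable A -> measurable B ->
  A `<=` B -> fine (P A) <= fine (P B).
Proof. by move=> mA mB AB; rewrite fine_le ?fin_num_measure// le_measure ?inE. Qed.

Lemma negligible_seq_fine (B : nat -> set Omega) (e : R) : negligible_seq P B ->
  0 < e -> \forall n \near \oo, fine (P (B n)) <= e.
Proof.
move=> [mB vB] e0; near=> n.
rewrite -lee_fin fineK ?fin_num_measure//.
by near: n; exact: vB.
Unshelve. all: by end_near. Qed.

End ProbabilityBounds.

(** * Selection and limit law *)

Section Selection.
Context {d} {Omega : measurableType d} {R : realType} (P : probability Omega R).
Variables (X U : {RV P >-> R}) (Xs Us : nat -> {RV P >-> R}).
Hypothesis ind_sample : mutually_independent P (fun s o => (Xs s o, Us s o)).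
Hypothesis law_sample : forall s,
  same_law P (fun o => (Xs s o, Us s o)) (fun o => (X o, U o)).
Variables (z w : nat -> R).
Local Notation pop h := (fun o => h (X o, U o)).
Local Notation sample h := (fun s o => h (Xs s o, Us s o)).
Hypothesis agap : forall i, abs_moments P (pop (gap_fun z w i)).
Hypothesis gap0 : forall i, \int[P]_o (pop (gap_fun z w i)) o = 0.

Let Shat n k o := Sigma_hat z w (fun s => Xs s o) (fun s => Us s o) n k.
Let T n k o := Tstat z w (fun s => Xs s o) (fun s => Us s o) n k.
Let S K n o := Sstat z w (fun s => Xs s o) (fun s => Us s o) K n.

Lemma in_bigsetU (I : finType) (B : I -> set Omega) o i :
  B i o -> (\big[setU/set0]_i B i) o.
Proof. by move=> Bi; rewrite (bigD1 i)//=; left. Qed.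

Lemma Tstat_small k : (0 < k)%N -> posdefmx (Sigma_pop X U z w k) ->
  exists2 B, negligible_seq P B & forall n o, ~ B n o -> T n k o < ln n%:R.
Proof.
move=> k0 pS; have [c c0 cS] := posdefmx_coercive pS.
have kR : 0 < k%:R :> R by rewrite ltr0n.
(* Both thresholds are equal shares: the [k * k] entry errors add up to at most [c / 2], halving the
   coercivity constant, and the k squared coordinates of [Jstat] add up to less than
   [c / 2 * ln n]. *)
pose e := c / 2 / k%:R / k%:R; have e0 : 0 < e by rewrite !divr_gt0.
pose a := c / 2 / k%:R; have a0 : 0 < a by rewrite !divr_gt0.
pose B1 (i j : 'I_k) n := [set o | e <= `|n%:R^-1 * \sum_(s < n)
  (sample (gap_fun z w i) s o * sample (gap_fun z w j) s o) -
  \int[P]_o (pop (gap_fun z w i) o * pop (gap_fun z w j) o)|].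
pose B2 (i : 'I_k) n := [set o | a * ln n%:R <=
  n%:R^-1 * (\sum_(s < n) sample (gap_fun z w i) s o) ^+ 2].
have mg := @measurable_gap_fun R z w.
have vB1 i j : negligible_seq P (B1 i j).
  apply: (weak_law ind_sample law_sample (h := fun p => gap_fun z w i p * gap_fun z w j p)) => //.
    exact: measurable_funM.
  exact: abs_momentsM.
have vB2 i : negligible_seq P (B2 i) by exact: tight_sum.
exists (fun n => (\big[setU/set0]_i \big[setU/set0]_j B1 i j n) `|`
    \big[setU/set0]_i B2 i n).
  apply: negligible_seqU; apply: negligible_seq_bigU => // i.
  exact: negligible_seq_bigU.
move=> n o nB.
have n1 i j : `|(Shat n k o - Sigma_pop X U z w k) i j| < e.
  rewrite ltNge; apply/negP => h; apply: nB; left.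
  apply: (@in_bigsetU _ _ o i); apply: (@in_bigsetU _ _ o j).
  by move: h; rewrite mxE /Shat Sigma_hatE !mxE.
have n2 (i : 'I_k) : n%:R^-1 * (\sum_(s < n) sample (gap_fun z w i) s o) ^+ 2 < a * ln n%:R.
  rewrite ltNge; apply/negP => h; apply: nB; right.
  by apply: (@in_bigsetU _ _ o i); exact: h.
have close : \sum_i \sum_j `|(Shat n k o - Sigma_pop X U z w k) i j| <= c / 2.
  rewrite (@le_trans _ _ (\sum_(i < k) \sum_(j < k) e))//.
    by apply: ler_sum => i _; apply: ler_sum => j _; exact/ltW.
  rewrite !sumr_const card_ord -[e *+ k *+ k]mulr_natr -[e *+ k]mulr_natr.
  by rewrite /e !divfK ?gt_eqF.
have c2 : 0 < c / 2 by rewrite divr_gt0.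
have := quadratic_inverse_le (Jstat z w (fun s => Xs s o) (fun s => Us s o) n k)
  c2 (bform_perturb cS close).
rewrite -/(Tstat _ _ _ _ _ _) => /le_lt_trans; apply.
rewrite ltr_pdivrMl// sqnorm_Jstat mulr_sumr.
apply: (@lt_le_trans _ _ (\sum_(i < k) a * ln n%:R)).
  apply: ltr_sum => [|i _]; last exact: n2.
  by apply/hasP; exists (Ordinal k0); rewrite ?mem_index_enum.
by rewrite sumr_const card_ord -[_ *+ k]mulr_natr mulrAC /a divfK// gt_eqF.
Qed.

Variable K : nat.
Hypothesis K_gt0 : (0 < K)%N.
Hypothesis pS : forall k, (1 <= k <= K)%N -> posdefmx (Sigma_pop X U z w k).

Lemma Sstat_eq1_whp : exists2 B, negligible_seq P B &
  forall n o, (0 < n)%N -> ~ B n o -> S K n o = 1%N.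
Proof.
have /choice[B HB] (k : nat) : exists B, (1 <= k <= K)%N -> negligible_seq P B /\
    forall n o, ~ B n o -> T n k o < ln n%:R.
  have [kK|kK] := boolP (1 <= k <= K)%N; last by exists (fun=> setT).
  have /andP[k0 _] := kK.
  by have [B vB TB] := Tstat_small k0 (pS kK); exists B.
exists (fun n => \big[setU/set0]_(k < K) B k.+1 n).
  by apply: negligible_seq_bigU => k; have [] := HB k.+1 (ltn_ord k).
move=> n o n0 nB; apply: Sstat_eq1 => // -[//|k] /andP[k2 kK].
have [_] := HB k.+1 kK; apply => Bk; apply: nB.
exact: (@in_bigsetU _ (fun k : 'I_K => B k.+1 n) o (Ordinal kK)).
Qed.

End Selection.

(** * Convergence of the distribution functions *)

Section Limit.
Context {d} {Omega : measurableType d} {R : realType} (P : probability Omega R).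
Variables (X U : {RV P >-> R}) (Xs Us : nat -> {RV P >-> R}).
Hypothesis ind_sample : mutually_independent P (fun s o => (Xs s o, Us s o)).
Hypothesis law_sample : forall s,
  same_law P (fun o => (Xs s o, Us s o)) (fun o => (X o, U o)).
Variables (z w : nat -> R).
Local Notation pop h := (fun o => h (X o, U o)).
Local Notation sample h := (fun s o => h (Xs s o, Us s o)).
Local Notation gauss := (@normal_prob R 0 1).
Hypothesis agap : forall i, abs_moments P (pop (gap_fun z w i)).
Hypothesis gap0 : forall i, \int[P]_o (pop (gap_fun z w i)) o = 0.
Variable K : nat.
Hypothesis K_gt0 : (0 < K)%N.
Hypothesis pS : forall k, (1 <= k <= K)%N -> posdefmx (Sigma_pop X U z w k).

Let T n o := Tstat z w (fun s => Xs s o) (fun s => Us s o) n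
  (Sstat z w (fun s => Xs s o) (fun s => Us s o) K n).
Let h := gap_fun z w 0.
Let v := \int[P]_o (pop h o ^+ 2).
Let Wn n o := (Num.sqrt n%:R)^-1 * \sum_(s < n) sample h s o.
Let Rn n o := n%:R^-1 * \sum_(s < n) sample h s o ^+ 2.

Let mh : measurable_fun setT h.
Proof. exact: measurable_gap_fun. Qed.

Let v_gt0 : 0 < v.
Proof.
have [_ /(_ (const_mx 1))] := pS (k := 1%N) K_gt0.
have c0 : const_mx 1 != 0 :> 'cV[R]_1.
  by apply/eqP => /colP/(_ 0); rewrite !mxE => /eqP; rewrite oner_eq0.
move=> /(_ c0); rewrite -[X in _ < X]/(bform _ _ _) bformE !big_ord1 !mxE.
by rewrite mul1r mulr1; under eq_Rintegral do rewrite -expr2.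
Qed.

Lemma clt_sample (M : R) g g1 g2 : smooth3 M g g1 g2 -> (forall x, 0 <= g x) ->
  \int[P]_o (g ((Num.sqrt v)^-1 * Wn n o)) @[n --> \oo] --> \int[gauss]_y g y.
Proof.
move=> sg g0; set c := (Num.sqrt v)^-1.
pose f p := c * h p.
have mf : measurable_fun setT f by exact: measurable_funM.
have af : abs_moments P (pop f).
  by apply: abs_momentsM; [exact: abs_moments_cst|exact: agap].
have af_ s := sample_abs_moments law_sample s mf af.
have v0 := v_gt0.
have WE n : \int[P]_o (g (c * Wn n o)) =
    \int[P]_o (g ((Num.sqrt n%:R)^-1 * partial_sum (sample f) n o)).
  by apply: eq_Rintegral => o _; rewrite /partial_sum -mulr_sumr mulrCA.
under eq_fun do rewrite WE.
apply: (@central_limit_smooth _ _ _ P (sample f) _ _ _ _ _ _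
  (\int[P]_o (`|pop f o| ^+ 3)) _ M g g1 g2 sg g0).
- exact: sample_independent.
- by move=> s; exact: (abs_moments_integrable (af_ s)).
- by move=> s; exact: (abs_moments_integrable (abs_momentsX 2 (af_ s))).
- by move=> s; have [_ +] := af_ s; exact.
- move=> s; apply: (etrans (sample_expectation law_sample s mf af)).
  have ih := abs_moments_integrable (agap 0).
  by rewrite RintegralZl// (gap0 0) mulr0.
- move=> s; have mf2 : measurable_fun setT (fun p => f p ^+ 2) by exact: measurable_funX.
  apply: (etrans (sample_expectation law_sample s mf2 (abs_momentsX 2 af))).
  under eq_Rintegral do rewrite exprMn.
  rewrite RintegralZl//; last by apply/abs_moments_integrable/abs_momentsX; exact: agap.
  by rewrite -/v /c exprVn sqr_sqrtr ?ltW// mulVf// gt_eqF.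
- move=> s; have mf3 : measurable_fun setT (fun p => `|f p| ^+ 3).
    by apply: measurable_funX; apply: measurableT_comp => //; exact: normr_measurable.
  have af3 : abs_moments P (pop (fun p => `|f p| ^+ 3)).
    apply: abs_momentsX; have [mF iF] := af; split.
      by apply: measurableT_comp => //; exact: normr_measurable.
    by move=> k; have := iF k; apply: eq_integrable => // o _; rewrite /= normr_id.
  by have := sample_expectation law_sample s mf3 af3; rewrite /= => ->.
Qed.

(** Stands in for Slutsky's theorem: off an event of vanishing probability the statistic is an
    explicit ratio whose denominator lies in a fixed neighbourhood of [v]. *)
Lemma Tstat_Sstat_whp (e : R) : 0 < e -> exists2 B, negligible_seq P B &
  forall n o, (0 < n)%N -> ~ B n o ->
    T n o = Wn n o ^+ 2 / Rn n o /\ `|Rn n o - v| < e.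
Proof.
move=> e0; have [B vB HB] := Sstat_eq1_whp ind_sample law_sample agap gap0 K_gt0 pS.
have mh2 : measurable_fun setT (fun p => h p ^+ 2) by exact: measurable_funX.
have vC := weak_law ind_sample law_sample mh2 (abs_momentsX 2 (agap 0)) e0.
eexists; first exact: negligible_seqU vB vC.
move=> n o n0 nBC; split.
  rewrite /T HB//; last by move=> Bn; apply: nBC; left.
  exact: Tstat1E.
by rewrite ltNge; apply/negP => he; apply: nBC; right.
Qed.

Let F (y : R) := fine (gauss [set x | x ^+ 2 <= y]).

Let measurable_sq (y : R) : measurable [set x : measurableTypeR R | (x : R) ^+ 2 <= y].
Proof.
have -> : [set x : R | x ^+ 2 <= y] = (fun x : R => x ^+ 2) @^-1` `]-oo, y].
  by apply/seteqP; split => x /=; rewrite in_itv.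
by rewrite -[_ @^-1` _]setTI; apply: exprn_measurable.
Qed.

Let mT n : measurable_fun setT (T n).
Proof. by apply: measurable_Tstat_Sstat => s. Qed.

Let mA n x : measurable [set o | T n o <= x].
Proof.
have -> : [set o | T n o <= x] = T n @^-1` `]-oo, x].
  by apply/seteqP; split => o /=; rewrite in_itv.
exact: measurable_preimage.
Qed.

Let W2E n o : ((Num.sqrt v)^-1 * Wn n o) ^+ 2 = Wn n o ^+ 2 / v.
Proof. by rewrite exprMn exprVn sqr_sqrtr 1?mulrC// ltW. Qed.

Let mWn n : measurable_fun setT (fun o => (Num.sqrt v)^-1 * Wn n o).
Proof.
apply: measurable_funM => //; apply: measurable_funM => //.
by apply: measurable_sum => s; exact: measurable_sample.
Qed.

(** Off [B], [T <= x] forces [Wn ^+ 2 / v <= m], where the plateau equals 1; and the plateau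
    vanishes where the square exceeds [y], so its Gaussian integral is at most [F y]. The midpoint
    [m] leaves room for the error of the denominator. *)
Lemma Tstat_cdf_upper (x y e : R) : 0 <= x -> x < y -> 0 < e ->
  \forall n \near \oo, fine (P [set o | T n o <= x]) <= F y + e.
Proof.
move=> x0 xy e0; have v0 := v_gt0.
pose m := (x + y) / 2; have xm : x < m by rewrite /m; lra.
have my : m < y by rewrite /m; lra.
have m0 : 0 <= m by lra.
have ab : 0 <= Num.sqrt m < Num.sqrt y.
  by rewrite sqrtr_ge0 ltr_sqrt//; lra.
have [M [g [g1 [g2 [sg g01 ga gb]]]]] := plateau ab.
have [bg _ _ _] := sg.
have g0 u : 0 <= g u by have /andP[] := g01 u.
have gle1 u : g u <= 1 by have /andP[] := g01 u.
(* The first bound gives [x * (1 + dl) <= m], with [x + 1] as divisor because [x] may be 0; the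
   second keeps [Rn] at least [v / 2], hence positive. *)
pose dl := Num.min ((m - x) / (x + 1)) 2^-1.
have dl0 : 0 < dl by rewrite lt_min invr_gt0 divr_gt0 /=; lra.
have dl1 : dl <= 2^-1 by rewrite ge_min lexx orbT.
have dlx : dl * (x + 1) <= m - x.
  by rewrite -ler_pdivlMr ?ge_min ?lexx//; lra.
have [B vB HB] := Tstat_Sstat_whp (mulr_gt0 dl0 v0).
have e2 : 0 < e / 2 by rewrite divr_gt0.
have /cvgrPdist_le/(_ _ e2) clt := clt_sample sg g0.
have intg : \int[gauss]_u g u <= F y.
  apply: Rintegral_le_probability => //.
    apply: (@integrable_EFin_bounded _ _ _ gauss M); last by case: bg.
    exact: bounded_lip_measurable bg.
  move=> u /negP; rewrite -ltNge => yu; rewrite gb// sqr_sqrtr//; lra.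
near=> n.
have n0 : (0 < n)%N by near: n; exact: nbhs_infty_gt.
have hB : fine (P (B n)) <= e / 2 by near: n; exact: negligible_seq_fine.
have hg : `|\int[gauss]_u g u - \int[P]_o (g ((Num.sqrt v)^-1 * Wn n o))| <= e / 2.
  by near: n; exact: clt.
have [mB _] := vB.
have ig := integrable_bounded_lip_comp P bg (mWn n).
have sub : fine (P ([set o | T n o <= x] `\` B n)) <=
    \int[P]_o (g ((Num.sqrt v)^-1 * Wn n o)).
  apply: probability_le_Rintegral => //; first exact: measurableD.
  move=> o [/= Tx nB]; have [TE] := HB n o n0 nB.
  rewrite ltr_norml => /andP[R1 R2]; rewrite ga// W2E sqr_sqrtr//.
  have R0 : 0 < Rn n o by nra.
  move: Tx; rewrite TE ler_pdivrMr// => Tx.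
  by rewrite ler_pdivrMr//; nra.
have AU : [set o | T n o <= x] `<=` ([set o | T n o <= x] `\` B n) `|` B n.
  by move=> o To; have [Bo|nBo] := pselect (B n o); [right|left].
have mD : measurable ([set o | T n o <= x] `\` B n) by exact: measurableD.
have := fine_probabilityS P (mA n x) (measurableU _ _ mD (mB n)) AU.
move=> /le_trans; apply; apply: (le_trans (fine_probabilityU P mD (mB n))).
rewrite (splitr e) addrA; apply: lerD hB; apply: (le_trans sub).
by rewrite -lerBlDl (le_trans (lerB (lexx _) intg))// (le_trans _ hg)// -normrN opprB ler_norm.
Unshelve. all: by end_near. Qed.

Lemma Tstat_cdf_lower (x y e : R) : 0 < y -> y < x -> 0 < e ->
  \forall n \near \oo, F y - e <= fine (P [set o | T n o <= x]).
Proof.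
move=> y0 yx e0; have v0 := v_gt0.
pose m := (x + y) / 2; have mx : m < x by rewrite /m; lra.
have ym : y < m by rewrite /m; lra.
have m0 : 0 <= m by lra.
have ab : 0 <= Num.sqrt y < Num.sqrt m.
  by rewrite sqrtr_ge0 ltr_sqrt//; lra.
have [M [g [g1 [g2 [sg g01 ga gb]]]]] := plateau ab.
have [bg _ _ _] := sg.
have g0 u : 0 <= g u by have /andP[] := g01 u.
have gle1 u : g u <= 1 by have /andP[] := g01 u.
(* Chosen so that [m <= x * (1 - dl)]: off [B], a sum with [Wn ^+ 2 / v <= m] then has [T <= x].
   Here [x] is positive and may serve as divisor. *)
pose dl := Num.min ((x - m) / x) 2^-1.
have dl0 : 0 < dl by rewrite lt_min invr_gt0 divr_gt0 /=; lra.
have dl1 : dl <= 2^-1 by rewrite ge_min lexx orbT.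
have dlx : dl * x <= x - m.
  by rewrite -ler_pdivlMr ?ge_min ?lexx//; lra.
have [B vB HB] := Tstat_Sstat_whp (mulr_gt0 dl0 v0).
have e2 : 0 < e / 2 by rewrite divr_gt0.
have /cvgrPdist_le/(_ _ e2) clt := clt_sample sg g0.
have intg : F y <= \int[gauss]_u g u.
  apply: probability_le_Rintegral => //.
    apply: (@integrable_EFin_bounded _ _ _ gauss M); last by case: bg.
    exact: bounded_lip_measurable bg.
  by move=> u /= uy; rewrite ga// sqr_sqrtr// ltW.
near=> n.
have n0 : (0 < n)%N by near: n; exact: nbhs_infty_gt.
have hB : fine (P (B n)) <= e / 2 by near: n; exact: negligible_seq_fine.
have hg : `|\int[gauss]_u g u - \int[P]_o (g ((Num.sqrt v)^-1 * Wn n o))| <= e / 2.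
  by near: n; exact: clt.
have [mB _] := vB.
have ig := integrable_bounded_lip_comp P bg (mWn n).
have sub : \int[P]_o (g ((Num.sqrt v)^-1 * Wn n o)) <=
    fine (P ([set o | T n o <= x] `|` B n)).
  apply: Rintegral_le_probability => //; first exact: measurableU.
  move=> o nTB; have nB : ~ B n o by move=> Bo; apply: nTB; right.
  have [TE] := HB n o n0 nB; rewrite ltr_norml => /andP[R1 R2].
  rewrite gb// W2E sqr_sqrtr// ltNge; apply/negP; rewrite ler_pdivrMr// => Wm.
  apply: nTB; left; rewrite /= TE; have R0 : 0 < Rn n o by nra.
  by rewrite ler_pdivrMr//; nra.
have := le_trans sub (fine_probabilityU P (mA n x) (mB n)).
move=> /le_trans/(_ (lerD (lexx _) hB)) ub.
rewrite lerBlDr (splitr e) addrA (le_trans intg)//.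
by rewrite -lerBlDr (le_trans _ ub)// lerBlDl -lerBlDr (le_trans (ler_norm _) hg).
Unshelve. all: by end_near. Qed.

Lemma Tstat_cdf_neg (x e : R) : x < 0 -> 0 < e ->
  \forall n \near \oo, fine (P [set o | T n o <= x]) <= e.
Proof.
(* Taking [v] itself as tolerance makes [Rn] positive off [B], so that [T] cannot be negative
   there. *)
move=> x0 e0; have [B vB HB] := Tstat_Sstat_whp v_gt0; near=> n.
have n0 : (0 < n)%N by near: n; exact: nbhs_infty_gt.
have hB : fine (P (B n)) <= e by near: n; exact: negligible_seq_fine.
have [mB _] := vB; rewrite (le_trans _ hB)// fine_probabilityS// => o /= Tx.
apply: contrapT => nB; have [TE] := HB n o n0 nB.
rewrite ltr_norml => /andP[R1 _]; have R0 : 0 <= Rn n o by lra.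
have : 0 <= T n o by rewrite TE divr_ge0// sqr_ge0.
lra.
Unshelve. all: by end_near. Qed.

Lemma chi_square1_cdf (y : R) : chi_square1 `]-oo, y]%classic = (F y)%:E.
Proof.
rewrite /F fineK; last by rewrite fin_num_measure.
by rewrite /chi_square1 /distribution /pushforward; congr (gauss _).
Qed.

Lemma Tstat_Sstat_cvg_in_distribution : cvg_in_distribution P T chi_square1.
Proof.
split=> [n|x]; first exact: mT.
move=> cx; rewrite chi_square1_cdf.
have cF : F y @[y --> x] --> F x.
  have cE : (fun y => chi_square1 `]-oo, y]%classic) = EFin \o F.
    by apply/funext => y; exact: chi_square1_cdf.
  by move: cx; rewrite cE => /fine_cvgP[_].
have F0 y : 0 <= F y by exact: fine_ge0.
have Fneg y : y < 0 -> F y = 0.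
  move=> y0; rewrite /F (_ : [set x | _] = set0) ?measure0//.
  apply/seteqP; split => // u /= uy; have := sqr_ge0 u.
  by move: (u ^+ 2) uy => q; lra.
rewrite (_ : (fun n => _) = fun n => (fine (P [set o | T n o <= x]))%:E); last first.
  by apply/funext => n; rewrite fineK// fin_num_measure.
apply: cvg_EFin; first by near=> n.
apply/cvgrPdist_le => e e0.
have e2 : 0 < e / 2 by rewrite divr_gt0.
have [dl /= dl0 Hdl] : \forall y \near x, `|F x - F y| <= e / 2.
  by move/cvgrPdist_le : cF; apply.
have near_x y : `|x - y| < dl -> `|F x - F y| <= e / 2 by exact: Hdl.
have up : \forall n \near \oo, fine (P [set o | T n o <= x]) <= F x + e.
  have [x0|x0] := ltrP x 0.
    near=> n; rewrite (@le_trans _ _ e)//; last by rewrite lerDr.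
    by near: n; exact: Tstat_cdf_neg.
  have xy : x < x + dl / 2 by lra.
  near=> n; apply: (@le_trans _ _ (F (x + dl / 2) + e / 2)).
    by near: n; exact: Tstat_cdf_upper.
  have := near_x (x + dl / 2); rewrite opprD addrA subrr add0r normrN gtr0_norm; last lra.
  have lt2 : dl / 2 < dl by lra.
  move=> /(_ lt2); rewrite ler_norml => /andP[? ?]; lra.
have lo : \forall n \near \oo, F x - e <= fine (P [set o | T n o <= x]).
  (* For [x <= 0] the function [F] vanishes to the left of [x], so continuity at [x] gives
     [F x <= e / 2] and the lower bound is negative. *)
  have [x0|x0] := lerP x 0.
    near=> n; have := near_x (x - dl / 2); rewrite opprB addrCA subrr addr0.
    rewrite gtr0_norm; last lra.
    have lt2 : dl / 2 < dl by lra.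
    rewrite (Fneg (x - dl / 2)) ?subr0; last lra.
    move=> /(_ lt2); rewrite ler_norml => /andP[? ?].
    have : 0 <= fine (P [set o | T n o <= x]) by exact: fine_ge0.
    lra.
  (* The first term keeps [y] within [dl] of [x], the second keeps it positive, as the lower bound
     requires. *)
  pose y := Num.max (x - dl / 2) (x / 2).
  have yx : y < x by rewrite gt_max; apply/andP; split; lra.
  have y0 : 0 < y by rewrite lt_max; apply/orP; right; lra.
  have xy : x - dl / 2 <= y by rewrite le_max lexx.
  near=> n; apply: (@le_trans _ _ (F y - e / 2)).
    have := near_x y; rewrite ger0_norm; last lra.
    have lt2 : x - y < dl by lra.
    move=> /(_ lt2); rewrite ler_norml => /andP[? ?]; lra.
  by near: n; exact: Tstat_cdf_lower.
near=> n.
have h1 : fine (P [set o | T n o <= x]) <= F x + e by near: n; exact: up.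
have h2 : F x - e <= fine (P [set o | T n o <= x]) by near: n; exact: lo.
by rewrite ler_norml; apply/andP; split; lra.
Unshelve. all: by end_near. Qed.

End Limit.

Theorem theorem1 (R : realType) (dO : measure_display)
    (Omega : measurableType dO) (P : probability Omega R)
    (X Y Z U V W : {RV P >-> R})
    (XE : forall o, X o = Y o + Z o) (UE : forall o, U o = V o + W o)
    (indYZ : independent_pair P Y Z) (indVW : independent_pair P V W)
    (indZW : independent_pair P Z W)
    (momX : has_all_moments P X) (momY : has_all_moments P Y)
    (momZ : has_all_moments P Z) (momU : has_all_moments P U)
    (momV : has_all_moments P V) (momW : has_all_moments P W)
    (detX : moment_determinate P X) (detY : moment_determinate P Y)
    (detZ : moment_determinate P Z) (detU : moment_determinate P U)
    (detV : moment_determinate P V) (detW : moment_determinate P W)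
    (Xs Us : nat -> {RV P >-> R})
    (ind_sample : mutually_independent P (fun s o => (Xs s o, Us s o)))
    (law_sample : forall s,
       same_law P (fun o => (Xs s o, Us s o)) (fun o => (X o, U o)))
    (d : nat -> nat)
    (Sigma_posdef : {ae P, forall o, \forall n \near \oo, forall k : nat,
       (1 <= k <= d n)%N ->
       posdefmx (Sigma_hat (moment P Z) (moment P W)
                   (fun s => Xs s o) (fun s => Us s o) n k)})
    (K : nat) (K_ge1 : (1 <= K)%N) (dK : forall n, d n = K)
    (H0 : same_law P Y V) :
  cvg_in_distribution P
    (fun n o =>
       let T := Tstat (moment P Z) (moment P W)
                  (fun s => Xs s o) (fun s => Us s o) n in
       let S := Sstat (moment P Z) (moment P W)
                  (fun s => Xs s o) (fun s => Us s o) (d n) n in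
       T S)
    chi_square1.
Proof.
have aY := has_all_moments_abs momY; have aZ := has_all_moments_abs momZ.
have aV := has_all_moments_abs momV; have aW := has_all_moments_abs momW.
have aX := has_all_moments_abs momX; have aU := has_all_moments_abs momU.
have agap i : abs_moments P
    (fun o => gap_fun (moment P Z) (moment P W) i (X o, U o)).
  by apply: abs_momentsB; exact: abs_moments_horner.
(* The null hypothesis enters here: the two deconvolved expectations are the moments of [Y] and of
   [V] of order [i.+1], which coincide when the laws do. *)
have gap0 i : \int[P]_o gap_fun (moment P Z) (moment P W) i (X o, U o) = 0.
  have iX := abs_moments_integrable (abs_moments_horner (deconv_poly (moment P Z) i.+1) aX).
  have iU := abs_moments_integrable (abs_moments_horner (deconv_poly (moment P W) i.+1) aU).
  rewrite RintegralB//; under eq_Rintegral do rewrite XE.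
  under [X in _ - X]eq_Rintegral do rewrite UE.
  rewrite !expectation_deconv_poly// !momentE; apply/eqP; rewrite subr_eq0; apply/eqP.
  have mX : measurable_fun setT (fun x : R => x ^+ i.+1) by exact: exprn_measurable.
  apply: same_law_Rintegral; [|exact: same_law_comp mX H0|].
    by have [] := abs_momentsX i.+1 aV.
  exact/abs_moments_integrable/abs_momentsX.
rewrite /=; under eq_fun do rewrite dK.
apply: (Tstat_Sstat_cvg_in_distribution ind_sample law_sample agap gap0 K_ge1).
move=> k kK; apply: Sigma_pop_posdef => //.
apply: filterS Sigma_posdef => o; apply: filterS => n; apply.
by rewrite dK.
Qed.
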